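(* Let $(B,d)$ be a compact metric space, and let $A_n\subset B$ ($n\ge1$) and $A\subset B$ be compact sets with $\lim_{n\to\infty}\delta(A_n,A)=0$, where $\delta$ is the Hausdorff metric. For each $n\ge1$ let $\mu_n$ be a Borel probability measure with support $A_n$, let $\mu$ be a Borel probability measure with support $A$, and assume $\mu_n\Rightarrow\mu$ (weak convergence on $B$). Let $R_n\in\mathcal{RM}(A_n)\cap C(A_n^2)$ for each $n\ge1$, and assume $R_n\rightarrowtail R$ for some metric $R$ on $A$. Then $R\in\mathcal{RM}(A)\cap C(A^2)$. Let $\alpha>0$; then $$u^{(\alpha)}_n\rightarrowtail u^{(\alpha)},$$ where $u^{(\alpha)}_n$ is the resolvent kernel associated with $R_n,\mu_n$ for each $n\ge1$, and $u^{(\alpha)}$ is the resolvent kernel associated with $R,\mu$.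
   Context: **Hausdorff metric.** $\delta(A,A')=\inf\{\rho>0:A\subset B_\rho(A')\text{ and }A'\subset B_\rho(A)\}$, with $B_\rho(A)=\bigcup_{x\in A}\{y\in B:d(x,y)<\rho\}$. $\mu_n\Rightarrow\mu$ means $\int_Bf\,d\mu_n\to\int_Bf\,d\mu$ for all $f\in C(B)$. $C(A_n^2),C(A^2)$ denote continuous functions with respect to $d$. **Resistance metrics.** A resistance form on a finite set $V$ is a quadratic form $\mathcal{E}_V(f)=\frac12\sum_{x\ne y}c_{x,y}(f(x)-f(y))^2$ on the space $l(V)$ of real functions on $V$, with $c_{x,y}=c_{y,x}\in[0,\infty)$, such that $\mathcal{E}_V(f)=0$ iff $f$ is constant. $R:X\times X\to\mathbb{R}$ is a resistance metric on a set $X$ if for any finite $V\subset X$ there is a resistance form $\mathcal{E}_V$ on $V$ with $R(x,y)=\sup\{|f(x)-f(y)|^2/\mathcal{E}_V(f):f\in l(V)\text{ nonconstant}\}$ for $x,y\in V$. $\mathcal{RM}(X)$ is the set of resistance metrics on $X$. **Resistance forms.** A resistance form on a set $X$ is a pair $(\mathcal{E},\mathcal{F})$ such that: (RF1) $\mathcal{F}$ is a linear space of real functions on $X$ containing constants, $\mathcal{E}$ is a nonnegative symmetric quadratic form on $\mathcal{F}$, and $\mathcal{E}(f):=\mathcal{E}(f,f)=0$ iff $f$ is constant; (RF2) $(\mathcal{F}/\text{constants},\mathcal{E})$ is a Hilbert space; (RF3) for any finite $V\subset X$ and $u:V\to\mathbb{R}$ there is $f\in\mathcal{F}$ with $f|_V=u$;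 (RF4) for distinct $p,q\in X$, $\sup\{|f(p)-f(q)|^2/\mathcal{E}(f):f\in\mathcal{F}\text{ nonconstant}\}<\infty$; (RF5) if $f\in\mathcal{F}$ then $\bar f=(f\vee0)\wedge1\in\mathcal{F}$ and $\mathcal{E}(\bar f)\le\mathcal{E}(f)$. If $R$ is a resistance metric on $X$ with $(X,R)$ separable, there is a unique resistance form on $X$ for which the supremum in (RF4) equals $R(p,q)$ for all $p\ne q$ (Kigami); it is the resistance form associated with $R$. **Resolvent kernel.** Let $\alpha>0$, $R$ a bounded resistance metric on $X$ with $(X,R)$ separable, $\nu$ a Borel probability measure on $(X,R)$, $(\mathcal{E},\mathcal{F})$ the resistance form associated with $R$, and $\mathcal{E}^{(\alpha)}(f,g)=\mathcal{E}(f,g)+\alpha\int_Xfg\,d\nu$. For each $x\in X$ there is a unique $u^{(\alpha)}(x,\cdot)\in\mathcal{F}$ with $\mathcal{E}^{(\alpha)}(u^{(\alpha)}(x,\cdot),f)=f(x)$ for all $f\in\mathcal{F}$. The function $u^{(\alpha)}$ on $X\times X$ is the resolvent kernel associated with $R$ and $\nu$. **Convergence $\rightarrowtail$.** For functions $g_n$ on $A_n\times A_n$ and $g$ on $A\times A$, $g_n\rightarrowtail g$ means: for any $x,y\in A$ and $x_n,y_n\in A_n$ with $x_n\to x$, $y_n\to y$ in $(B,d)$, $g_n(x_n,y_n)\to g(x,y)$. *)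

(* Defs.v *)
From HB Require Import structures.
From mathcomp Require Import all_boot all_order all_algebra finmap.
From mathcomp Require Import all_classical all_reals all_analysis.
Import Order.TTheory GRing.Theory Num.Theory.
Import numFieldNormedType.Exports.

Set Implicit Arguments.
Unset Strict Implicit.
Unset Printing Implicit Defensive.

Local Open Scope classical_set_scope.
Local Open Scope ring_scope.

(* Measurable types of the library are pointed. *)
#[short(type="pmetricType")]
HB.structure Definition PointedMetric (K : numDomainType) :=
  { M of Metric K M & Pointed M }.

Notation borelType B := (g_sigma_algebraType (@open B)).

Section CompactSubsets.
Context {K : realType} {B : pmetricType K}.

(* Extended-real valued, so that the infimum over no radius is +oo. *)
Definition hausdorff_dist (A A' : set B) : \bar K :=
  ereal_inf [set rho%:E | rho in [set rho : K | [/\ 0 < rho,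
    A `<=` \bigcup_(x in A') ball x rho
    & A' `<=` \bigcup_(x in A) ball x rho]]].

Definition measure_support (mu : probability (borelType B) K) : set B :=
  [set x | forall U : set B, open U -> U x -> (0 < mu U)%E].

Definition weak_cvg (mu_ : nat -> probability (borelType B) K)
    (mu : probability (borelType B) K) : Prop :=
  forall f : B -> K, continuous f ->
    \int[mu_ n]_x f x @[n --> \oo] --> \int[mu]_x f x.

Definition cvg_along (A_ : nat -> set B) (A : set B)
    (g_ : forall n, A_ n -> A_ n -> K) (g : A -> A -> K) : Prop :=
  forall (x y : A) (x_ y_ : forall n, A_ n),
    set_val (x_ n) @[n --> \oo] --> (set_val x : B) ->
    set_val (y_ n) @[n --> \oo] --> (set_val y : B) ->
    g_ n (x_ n) (y_ n) @[n --> \oo] --> g x y.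

End CompactSubsets.

Section Resistance.
Context {K : realType}.

Record is_metric (X : Type) (R : X -> X -> K) : Prop := {
  metric_xx : forall x, R x x = 0;
  metric_eq0 : forall x y, R x y = 0 -> x = y;
  metric_symmetric : forall x y, R x y = R y x;
  metric_triangular : forall x y z, R x z <= R x y + R y z }.

Definition constant_fun (X : Type) (f : X -> K) : Prop := exists c, f = cst c.

Definition resistance_ratios (X : Type) (Q : (X -> K) -> K)
    (F : set (X -> K)) (x y : X) : set K :=
  [set `|f x - f y| ^+ 2 / Q f | f in [set f | F f /\ ~ constant_fun f]].

Definition conductance_energy (V : finType) (c : V -> V -> K) (f : V -> K) : K :=
  2^-1 * \sum_(x : V) \sum_(y : V | x != y) c x y * (f x - f y) ^+ 2.

Record is_conductance (V : finType) (c : V -> V -> K) : Prop := {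
  conductance_ge0 : forall x y, 0 <= c x y;
  conductance_sym : forall x y, c x y = c y x;
  conductance_eq0 : forall f : V -> K,
    conductance_energy c f = 0 <-> constant_fun f }.

(* The set of ratios is bounded because V is finite, so that sup is a genuine
   supremum; if V is a singleton, the set is empty and its sup is 0. *)
Definition resistance_metric (X : choiceType) (R : X -> X -> K) : Prop :=
  forall V : {fset X}, exists2 c : V -> V -> K, is_conductance c &
    forall x y : V,
      R (fsval x) (fsval y) = sup (resistance_ratios (conductance_energy c) [set: V -> K] x y).

(* E is only relevant on F.  A Cauchy sequence of the inner product space
   F / constants is written with representatives in F. *)
Record resistance_form (X : choiceType) (E : (X -> K) -> (X -> K) -> K)
    (F : set (X -> K)) : Prop := {
  rf_cst : forall c : K, F (cst c);
  rf_linear : forall (a : K) f g, F f -> F g -> F (a \*o f \+ g);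
  rf_bilinear : forall (a : K) f g h, F f -> F g -> F h ->
    E (a \*o f \+ g) h = a * E f h + E g h;
  rf_sym : forall f g, F f -> F g -> E f g = E g f;
  rf_ge0 : forall f, F f -> 0 <= E f f;
  rf_eq0 : forall f, F f -> (E f f = 0 <-> constant_fun f);
  rf_complete : forall u : nat -> X -> K, (forall n, F (u n)) ->
    (forall e : K, 0 < e -> exists N : nat, forall m n : nat,
      (N <= m)%N -> (N <= n)%N -> Num.sqrt (E (u m \- u n) (u m \- u n)) < e) ->
    exists2 f, F f &
      Num.sqrt (E (u n \- f) (u n \- f)) @[n --> \oo] --> (0 : K);
  rf_extend : forall (V : {fset X}) (u : V -> K),
    exists2 f, F f & forall x : V, f (fsval x) = u x;
  rf_bounded : forall p q : X, p != q ->
    has_ubound (resistance_ratios (fun f => E f f) F p q);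
  rf_markov : forall f, F f ->
    let f01 := fun x => Num.min (Num.max (f x) 0) 1 in
    F f01 /\ E f01 f01 <= E f f }.

Definition associated_form (X : choiceType) (R : X -> X -> K)
    (E : (X -> K) -> (X -> K) -> K) (F : set (X -> K)) : Prop :=
  resistance_form E F /\
  forall p q : X, p != q -> sup (resistance_ratios (fun f => E f f) F p q) = R p q.

(* The space X is a subset A of B, and the measure on A is the restriction to A
   of a Borel measure mu on B: functions on A are integrated over A after
   extension by 0.  When A is compact and the metric R is continuous on A * A,
   R induces the topology of A, so both have the same Borel sets. *)
Definition form_alpha {B : pmetricType K} (A : set B)
    (mu : probability (borelType B) K) (alpha : K)
    (E : (A -> K) -> (A -> K) -> K) (f g : A -> K) : K :=
  E f g + alpha * \int[mu]_(z in A) ('valL_0 f z * 'valL_0 g z).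

Definition resolvent_kernel {B : pmetricType K} (A : set B) (R : A -> A -> K)
    (mu : probability (borelType B) K) (alpha : K) (u : A -> A -> K) : Prop :=
  exists E F, associated_form R E F /\
    forall x : A, F (u x) /\
      forall f, F f -> form_alpha mu alpha E (u x) f = f x.

End Resistance.

(* Main.v *)
Require Import Defs.
From mathcomp Require Import all_boot all_order all_algebra finmap.
From mathcomp Require Import all_classical all_reals all_analysis.
From mathcomp Require Import lra ring measurable_realfun.
Import Order.TTheory GRing.Theory Num.Theory.
Import numFieldNormedType.Exports.

(** A resistance form is the reproducing kernel space of its resistance metric.
    With a base point o, the function
      green R o x : y |-> (R x o + R y o - R x y) / 2
    belongs to the domain and represents f |-> f x - f o for the energy
    ([rf_green]); only R enters its formula.  Testing the equation of the
    resolvent u = u(x, .) with green R x y and with the constant 1 therefore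
    gives an integral equation in which the form has disappeared:
      u y = u x - alpha * int (u * green R x y) dmu,   alpha * int u dmu = 1.
    Conversely its only continuous solution is the resolvent
    ([resolvent_unique]): the Riesz theorem puts a solution back into the domain
    of the form, where it solves the variational equation, and the difference
    of two variational solutions has zero energy and zero mean.

    This equation passes to the limit.  The functions u_n(x_n, .) satisfy
      (u_n(x_n, y) - u_n(x_n, z))^2 <= R_n(y, z) * u_n(x_n, x_n),
    and u_n(x_n, x_n) is bounded in terms of alpha and of a bound on
    R_n(x_n, .), so they are bounded and equicontinuous.  Along an ultrafilter
    that refines the neighbourhoods of infinity every bounded sequence
    converges, so a limit v(y) of u_n(x_n, y_n) exists; it depends only on the
    limit y of y_n, it is continuous, and weak convergence of the measures
    carries the integral equation over ([average_ultralimit]).  Hence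
    v = u(x, .).  The limit being the same along every ultrafilter, the
    sequence converges ([cvg_ultra]).

    The statements about R come from the convergence along moving points.  A
    diagonal argument makes it locally uniform ([cvg_along_uniform]), hence R is
    continuous.  For a finite subset V of A, approximating its points in A_n
    gives conductances on V whose resistances tend to R on V.  They are bounded,
    a conductance being at most the inverse of the corresponding resistance, so
    they have a limit along an ultrafilter, and R is the resistance of this
    limit network ([network_ultralimit]). *)

Set Implicit Arguments.
Unset Strict Implicit.
Unset Printing Implicit Defensive.

Local Open Scope classical_set_scope.
Local Open Scope ring_scope.

(** * Resistance forms as reproducing kernel spaces *)

Lemma discriminant_bound (K : realType) (a b c : K) : 0 <= c ->
  (forall t, 0 <= a + 2 * t * b + t ^+ 2 * c) -> b ^+ 2 <= a * c.
Proof.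
move=> cge0 ge0; have [c0|c0] := eqVneq c 0.
  have [->|b0] := eqVneq b 0; first by rewrite c0 expr0n mulr0.
  have := ge0 (- (a + 1) / (2 * b)); rewrite c0 mulr0 addr0.
  have -> : a + 2 * (- (a + 1) / (2 * b)) * b = -1 by field.
  by rewrite lerNr oppr0 ler10.
have cgt0 : 0 < c by rewrite lt_neqAle eq_sym c0.
have := ge0 (- b / c).
have -> : a + 2 * (- b / c) * b + (- b / c) ^+ 2 * c = a - b ^+ 2 / c by field.
by rewrite subr_ge0 ler_pdivrMr.
Qed.

Lemma sqrtr_cvg0 (K : realType) (u : nat -> K) : (forall n, 0 <= u n) ->
  Num.sqrt (u n) @[n --> \oo] --> (0 : K) -> u n @[n --> \oo] --> (0 : K).
Proof.
move=> u0 cu; have -> : u = (fun n => Num.sqrt (u n) * Num.sqrt (u n)).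
  by apply/funext => n; rewrite -expr2 sqr_sqrtr.
by rewrite -[0 in X in _ --> X](mulr0 (0 : K)); exact: cvgM.
Qed.

(** The Gromov product of x and y seen from o; it is the Green function of a
    resistance form with Dirichlet condition at o. *)
Definition green (K : realType) (X : Type) (R : X -> X -> K) (o x y : X) : K :=
  2^-1 * (R x o + R y o - R x y).

Section Riesz.
Context {K : realType} {X : choiceType}.
Context {E : (X -> K) -> (X -> K) -> K} {F : set (X -> K)}.
Hypothesis rf : resistance_form E F.

Lemma rfZ a f : F f -> F (a \*o f).
Proof.
move=> Ff; have := rf_linear rf a Ff (rf_cst rf 0); congr F.
by apply/funext => x /=; rewrite addr0.
Qed.

Lemma rfD f g : F f -> F g -> F (f \+ g).
Proof.
move=> Ff Fg; have := rf_linear rf 1 Ff Fg; congr F.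
by apply/funext => x /=; rewrite mul1r.
Qed.

Lemma rfB f g : F f -> F g -> F (f \- g).
Proof.
move=> Ff Fg; have := rf_linear rf (-1) Fg Ff; congr F.
by apply/funext => x /=; rewrite mulN1r addrC.
Qed.

Lemma rf0l h : F h -> E (cst 0) h = 0.
Proof.
move=> Fh; have F0 := rf_cst rf 0.
have := rf_bilinear rf (-1) F0 F0 Fh.
have -> : (-1) \*o cst (0 : K) \+ cst 0 = (cst 0 : X -> K).
  by apply/funext => x /=; rewrite mulr0 addr0.
by rewrite mulN1r addNr.
Qed.

Lemma rfZl a f h : F f -> F h -> E (a \*o f) h = a * E f h.
Proof.
move=> Ff Fh; have := rf_bilinear rf a Ff (rf_cst rf 0) Fh.
rewrite rf0l// addr0 => <-; congr E.
by apply/funext => x /=; rewrite addr0.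
Qed.

Lemma rfDl f g h : F f -> F g -> F h -> E (f \+ g) h = E f h + E g h.
Proof.
move=> Ff Fg Fh; have := rf_bilinear rf 1 Ff Fg Fh; rewrite mul1r => <-.
by congr E; apply/funext => x /=; rewrite mul1r.
Qed.

Lemma rfBl f g h : F f -> F g -> F h -> E (f \- g) h = E f h - E g h.
Proof.
move=> Ff Fg Fh; have := rf_bilinear rf (-1) Fg Ff Fh.
rewrite mulN1r addrC => <-.
by congr E; apply/funext => x /=; rewrite mulN1r addrC.
Qed.

Lemma rfDZ f h t : F f -> F h ->
  E (t \*o h \+ f) (t \*o h \+ f) = E f f + 2 * t * E f h + t ^+ 2 * E h h.
Proof.
move=> Ff Fh; have Fth := rfZ t Fh; have Fs := rfD Fth Ff.
rewrite rfDl// rfZl// (rf_sym rf Fh Fs) (rf_sym rf Ff Fs) !rfDl// !rfZl//.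
by rewrite (rf_sym rf Fh Ff); ring.
Qed.

Lemma rf_cauchy_schwarz f g : F f -> F g -> E f g ^+ 2 <= E f f * E g g.
Proof.
move=> Ff Fg; apply: discriminant_bound; first exact: rf_ge0 rf _ Fg.
by move=> t; rewrite -rfDZ//; apply: (rf_ge0 rf); apply: rfD => //; apply: rfZ.
Qed.

Lemma rf_cstl c h : F h -> E (cst c) h = 0.
Proof.
move=> Fh; have Fc := rf_cst rf c; have := rf_cauchy_schwarz Fc Fh.
have -> : E (cst c) (cst c) = 0 by apply/(rf_eq0 rf Fc); exists c.
by rewrite mul0r => h0; apply/eqP; rewrite -sqrf_eq0 eq_le h0 sqr_ge0.
Qed.

(** The functional J f = E f f - 2 l f is bounded below.  By the parallelogram
    identity a minimising sequence is Cauchy for the energy, and its limit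
    represents l because the first variation of J vanishes there.  The
    completeness axiom yields a limit modulo constants only, which is harmless:
    the bound on l makes it vanish on constants. *)
Lemma rf_riesz (l : (X -> K) -> K) (C : K) : 0 <= C ->
  (forall a f g, F f -> F g -> l (a \*o f \+ g) = a * l f + l g) ->
  (forall f, F f -> l f ^+ 2 <= C * E f f) ->
  exists2 psi, F psi & forall f, F f -> E psi f = l f.
Proof.
move=> C0 llin lbd; pose J f := E f f - 2 * l f.
pose V := [set J f | f in F].
have F0 := rf_cst rf (0 : K).
have Jlb f : F f -> - C <= J f.
  move=> Ff; have := rf_ge0 rf Ff; have := lbd f Ff; rewrite /J.
  move: (E f f) (l f) => e m me e0.
  suff h : 2 * m <= C + e; first lra.
  rewrite leNgt; apply/negP => lt; have := sqr_ge0 (C - e).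
  have h : (C + e) ^+ 2 < (2 * m) ^+ 2.
    by rewrite ltr_pXn2r// nnegrE; lra.
  nra.
have Vinf : has_inf V.
  split; first by exists (J (cst 0)); exists (cst 0).
  by exists (- C) => _ [f Ff <-]; exact: Jlb.
pose m := inf V.
have mJ f : F f -> m <= J f.
  by move=> Ff; apply: ge_inf; [exact: Vinf.2|exists f].
have [r r0 rcvg] : exists2 r : nat -> K, forall n, 0 < r n & r @ \oo --> (0 : K).
  by exists harmonic; [move=> n; rewrite /= invr_gt0|exact: cvg_harmonic].
have /choice[u uP] n : exists f, F f /\ J f < m + r n.
  by have [_ [f Ff <-] Jf] := inf_adherent (r0 n) Vinf; exists f.
have Fu n : F (u n) by case: (uP n).
have JDZ f h t : F f -> F h -> J (t \*o h \+ f) =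
    J f + 2 * t * (E f h - l h) + t ^+ 2 * E h h.
  by move=> Ff Fh; rewrite /J rfDZ// llin//; ring.
have ucauchy n k : E (u n \- u k) (u n \- u k) <= 2 * (r n + r k).
  have Fd := rfB (Fu n) (Fu k).
  have := mJ _ (rfD (rfZ (- 2^-1) Fd) (Fu n)).
  have Jk : J (u k) = J ((-1) \*o (u n \- u k) \+ u n).
    by congr J; apply/funext => x /=; ring.
  have := (uP n).2; have := (uP k).2; rewrite Jk !JDZ//.
  by move: (J (u n)) (E (u n) _ - l _) (E (u n \- u k) _) => a b d; lra.
have [|psi Fpsi upsi] := rf_complete rf Fu.
  move=> e e0; have e2 : 0 < e ^+ 2 / 4 by rewrite divr_gt0// exprn_gt0.
  have [N _ NP] := cvgr_lt _ rcvg _ e2.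
  exists N => n k Nn Nk; rewrite -(gtr0_norm e0) -sqrtr_sqr ltr_sqrt ?exprn_gt0//.
  have := ucauchy n k; have := NP n Nn; have := NP k Nk.
  by move: (E _ _) => d /=; lra.
exists psi => // h Fh.
have Fd n := rfB (Fu n) Fpsi.
have d0 : E (u n \- psi) (u n \- psi) @[n --> \oo] --> (0 : K).
  by apply: sqrtr_cvg0 => // n; exact: rf_ge0 rf _ (Fd n).
(* The quadratic t |-> J (u n + t h) - m is nonnegative and at most r n at 0. *)
have near_stationary n : (E (u n) h - l h) ^+ 2 <= r n * E h h.
  apply: discriminant_bound; first exact: rf_ge0 rf _ Fh.
  move=> t; have := mJ _ (rfD (rfZ t Fh) (Fu n)); rewrite JDZ//.
  by have := (uP n).2; move: (J (u n)) => a; lra.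
have bound n : (E psi h - l h) ^+ 2 <=
    2 * (E (u n \- psi) (u n \- psi) * E h h + r n * E h h).
  have := rf_cauchy_schwarz (Fd n) Fh; rewrite rfBl//.
  have := near_stationary n; move: (E (u n) h) (E psi h) (l h) => a b c.
  by have := sqr_ge0 ((a - b) + (a - c)); nra.
have bound0 : 2 * (E (u n \- psi) (u n \- psi) * E h h + r n * E h h)
    @[n --> \oo] --> (0 : K).
  rewrite [X in _ --> X](_ : 0 = 2 * (0 * E h h + 0 * E h h)); last first.
    by rewrite !mul0r addr0 mulr0.
  apply: cvgM; [exact: cvg_cst|apply: cvgD]; apply: cvgM => //; exact: cvg_cst.
have := cvgr_to_ge bound0 (nearW _ bound).
by move=> le0; apply/eqP; rewrite -subr_eq0 -sqrf_eq0 eq_le le0 sqr_ge0.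
Qed.

Section ReproducingKernel.
Context {R : X -> X -> K}.
Hypothesis Rxx : forall x, R x x = 0.
Hypothesis RE : forall p q, p != q ->
  sup (resistance_ratios (fun f => E f f) F p q) = R p q.

Lemma rf_separates x y : x != y -> exists f, [/\ F f, f x = 1 & f y = 0].
Proof.
move=> xy; pose V := [fset x; y]%fset.
have xV : x \in V by rewrite !inE eqxx.
have yV : y \in V by rewrite !inE eqxx orbT.
have [f Ff fV] := rf_extend rf (fun v : V => (fsval v == x)%:R).
exists f; split => //; first by have := fV [` xV]%fset; rewrite /= eqxx.
by have := fV [` yV]%fset; rewrite /= eq_sym (negPf xy).
Qed.

(** The supremum that defines the resistance is a Lipschitz-type bound; it turns
    bounds on the energy into equicontinuity. *)
Lemma rf_oscillation f x y : F f -> (f x - f y) ^+ 2 <= R x y * E f f.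
Proof.
move=> Ff; have [->|xy] := eqVneq x y; first by rewrite subrr Rxx mul0r expr0n.
have [[c ->]|nf] := pselect (constant_fun f).
  by rewrite rf_cstl ?mulr0 ?subrr ?expr0n//; exact: rf_cst rf c.
have Ef0 : 0 < E f f.
  rewrite lt_neqAle (rf_ge0 rf Ff) andbT eq_sym; apply/eqP.
  by move=> /(rf_eq0 rf Ff).
rewrite -RE// -ler_pdivrMr// -real_normK ?num_real//.
by apply: ub_le_sup; [exact: rf_bounded rf _ _ xy|exists f].
Qed.

Lemma rf_resistance_ge0 x y : 0 <= R x y.
Proof.
have [->|xy] := eqVneq x y; first by rewrite Rxx.
have [f [Ff fx fy]] := rf_separates xy.
have := rf_oscillation x y Ff; rewrite fx fy subr0 expr1n.
have := rf_ge0 rf Ff; move: (E f f) (R x y) => e r e0 re.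
by rewrite leNgt; apply/negP => r0; nra.
Qed.

(** The representer psi attains the supremum that defines R x y: its own ratio
    is E psi psi, and Cauchy-Schwarz bounds every other ratio by this value. *)
Lemma rf_representer_energy psi x y : F psi ->
  (forall f, F f -> E psi f = f x - f y) -> E psi psi = R x y.
Proof.
move=> Fpsi psiE; have [xy|xy] := eqVneq x y.
  by rewrite psiE// xy subrr Rxx.
have [f [Ff fx fy]] := rf_separates xy.
have npsi : ~ constant_fun psi.
  move=> [c psic]; have := psiE f Ff.
  by rewrite psic rf_cstl// fx fy subr0 => /esym/eqP; rewrite oner_eq0.
have Epsi0 : 0 < E psi psi.
  rewrite lt_neqAle (rf_ge0 rf Fpsi) andbT eq_sym; apply/eqP.
  by move=> /(rf_eq0 rf Fpsi).
rewrite -RE//; apply/eqP; rewrite eq_le; apply/andP; split.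
  apply: ub_le_sup; first exact: rf_bounded rf _ _ xy.
  exists psi => //; rewrite -psiE// real_normK ?num_real// expr2 mulfK//.
  exact: lt0r_neq0.
apply: ge_sup; first by exists (`|psi x - psi y| ^+ 2 / E psi psi), psi.
move=> _ [g [Fg ng] <-].
have Eg0 : 0 < E g g.
  rewrite lt_neqAle (rf_ge0 rf Fg) andbT eq_sym; apply/eqP.
  by move=> /(rf_eq0 rf Fg).
rewrite ler_pdivrMr// real_normK ?num_real// -psiE//.
exact: rf_cauchy_schwarz.
Qed.

(** The representers phi x of f |-> f x - f o, normalised to vanish at o, satisfy
    R x z = E (phi x - phi z) (phi x - phi z); expanding this square gives
    phi x z by polarisation. *)
Lemma rf_green o x : F (green R o x) /\
  forall f, F f -> E (green R o x) f = f x - f o.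
Proof.
have /choice[phi phiP] y : exists p, [/\ F p, p o = 0 &
    forall f, F f -> E p f = f y - f o].
  have [|||p Fp pE] := @rf_riesz (fun f => f y - f o) (R y o).
  - exact: rf_resistance_ge0.
  - by move=> a f g _ _ /=; ring.
  - by move=> f Ff; exact: rf_oscillation.
  have Fc := rf_cst rf (p o).
  exists (p \- cst (p o)); split; [exact: rfB|by rewrite /= subrr|].
  by move=> f Ff; rewrite rfBl// rf_cstl// subr0 pE.
have Fphi y : F (phi y) by case: (phiP y).
have phi0 y : phi y o = 0 by case: (phiP y).
have phiE y f : F f -> E (phi y) f = f y - f o by case: (phiP y) => _ _; exact.
suff -> : green R o x = phi x by split => //; exact: phiE.
apply/funext => z.
have Fd := rfB (Fphi x) (Fphi z).
have Ro y : R y o = phi y y.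
  by rewrite -(rf_representer_energy (Fphi y) (phiE y)) phiE// phi0 subr0.
have phiC : phi x z = phi z x.
  by have := rf_sym rf (Fphi x) (Fphi z); rewrite !phiE// !phi0 !subr0.
have dE f : F f -> E (phi x \- phi z) f = f x - f z.
  by move=> Ff; rewrite rfBl// !phiE//; ring.
rewrite /green -(rf_representer_energy Fd dE) dE//= !Ro -phiC.
by field.
Qed.

End ReproducingKernel.
End Riesz.

(** * Ultrafilters and Hausdorff limits *)

Lemma cvg_ultra (I : Type) (T : topologicalType) (F : set_system I)
    (u : I -> T) (l : T) : ProperFilter F ->
  (forall U, UltraFilter U -> F `<=` U -> u @ U --> l) -> u @ F --> l.
Proof.
move=> FF ul W Wl; apply: contrapT => nW.
pose D := ~` (u @^-1` W).
have GP : ProperFilter (within D F).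
  apply: Build_ProperFilter_ex => P; rewrite /within /= => DP.
  apply: contrapT => nP; apply: nW; apply: filterS DP => i /= iDP.
  by apply: contrapT => niW; apply: nP; exists i; apply: iDP.
have [U [UU GU]] := ultraFilterLemma GP.
have UD : U D by apply: GU; exact: withinT.
have UW : U (u @^-1` W).
  by apply: (ul U UU _ _ Wl) => P FP; apply: GU; apply: filterS FP.
by have [i []] := @filter_ex _ U _ _ (filterI UD UW).
Qed.

Lemma ultra_compact_cvg (I : Type) (T : topologicalType) (U : set_system I)
    (u : I -> T) (C : set T) : UltraFilter U -> compact C ->
  U (u @^-1` C) -> exists2 p, C p & u @ U --> p.
Proof.
move=> UU cC UC; have [p [Cp up]] := cC (u @ U) _ UC.
exists p => // W Wp; have [//|UW] := @in_ultra_setVsetC _ U (u @^-1` W) UU.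
by have [q [nWq /nWq]] := up (~` W) W UW Wp.
Qed.

(** Reduces a uniform bound over varying spaces to sequences of points: apply the
    hypothesis to a selection of counterexamples. *)
Lemma filter_selection (I : Type) (F : set_system I) (T : I -> Type)
    (P : forall i, T i -> Prop) : Filter F -> (forall i, T i) ->
  (forall p : forall i, T i, \forall i \near F, P i (p i)) ->
  \forall i \near F, forall z, P i z.
Proof.
move=> FF t0 selP.
have pick i : exists z, P i z -> forall z', P i z'.
  have [[z nz]|noz] := pselect (exists z, ~ P i z); first by exists z => /nz.
  by exists (t0 i) => _ z; apply: contrapT => nz; apply: noz; exists z.
apply: filterS (selP (fun i => projT1 (cid (pick i)))) => i.
exact: projT2 (cid (pick i)).
Qed.

Section HausdorffLimit.
Context {K : realType} {B : pmetricType K}.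
Context {A_ : nat -> set B} {A : set B}.
Hypothesis cvgA : hausdorff_dist (A_ n) A @[n --> \oo] --> 0%E.

Lemma hausdorff_near (rho : K) : 0 < rho -> \forall n \near \oo,
  A_ n `<=` \bigcup_(x in A) ball x rho /\ A `<=` \bigcup_(x in A_ n) ball x rho.
Proof.
move=> rho0; have rhoE : (0 < rho%:E)%E by rewrite lte_fin.
have : \forall n \near \oo, (hausdorff_dist (A_ n) A < rho%:E)%E.
  exact: cvgA (open_ereal_lt' rhoE).
apply: filterS => n /ereal_inf_lt[_ [r [r0 Ar rA] <-]]; rewrite lte_fin => rrho.
split=> [x /Ar|x /rA] [y By yx]; exists y => //; exact: le_ball (ltW rrho) _ yx.
Qed.

Hypothesis A_neq0 : forall n, exists x, A_ n x.

(** One choice phi serves all points at once; phi n x minimises the distance to x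
    up to an error 1 / (n + 1), so it does at least as well, up to this error, as
    the points supplied by the Hausdorff distance. *)
Lemma hausdorff_approx : exists phi : forall n, A -> A_ n,
  forall x : A, set_val (phi n x) @[n --> \oo] --> (set_val x : B).
Proof.
have near_point n (x : A) : exists a : A_ n, forall b : A_ n,
    mdist (set_val x) (set_val a) <= mdist (set_val x) (set_val b) + n.+1%:R^-1.
  pose S := [set mdist (set_val x) (set_val a) | a in [set: A_ n]].
  have [a0 Aa0] := A_neq0 n.
  have Sinf : has_inf S.
    split; first by exists (mdist (set_val x) a0), (SigSub (mem_set Aa0)).
    by exists 0 => _ [a _ <-]; exact: mdist_ge0.
  have n0 : 0 < n.+1%:R^-1 :> K by rewrite invr_gt0.
  have [_ [a _ <-] Sa] := inf_adherent n0 Sinf.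
  exists a => b; rewrite (le_trans (ltW Sa))// lerD2r.
  by apply: ge_inf; [exact: Sinf.2|exists b].
pose phi n x := projT1 (cid (near_point n x)).
exists phi => x; apply/cvg_ballP => e e0.
have e2 : 0 < e / 2 by rewrite divr_gt0.
have := near_infty_natSinv_lt (PosNum e2); have := hausdorff_near e2.
apply: filterS2 => n [_ AA] /= ne.
have [b Ab] := AA _ (set_valP x); rewrite ballEmdist /= => bx.
rewrite ballEmdist /=.
have := projT2 (cid (near_point n x)) (SigSub (mem_set Ab)).
rewrite -/(phi n x) /= => /le_lt_trans; apply.
by rewrite (splitr e) ltrD// metric_sym.
Qed.

Lemma hausdorff_ultra_limit (U : set_system nat) (p_ : forall n, A_ n) :
    compact [set: B] -> closed A -> UltraFilter U -> \oo `<=` U ->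
  exists p : A, set_val (p_ n) @[n --> U] --> (set_val p : B).
Proof.
move=> cB clA UU ooU.
have [b _ pb] : exists2 b, [set: B] b & set_val (p_ n) @[n --> U] --> (b : B).
  by apply: ultra_compact_cvg => //; exact: filterT.
suff Ab : A b by exists (SigSub (mem_set Ab)).
apply: clA => W /nbhs_ballP[e /= e0 eW].
have e2 : 0 < e / 2 by rewrite divr_gt0.
have [n [pn An]] := @filter_ex _ U _ _
  (filterI (cvg_ball pb e2) (ooU _ (hausdorff_near e2))).
have [a Aa ap] := An.1 _ (set_valP (p_ n)).
exists a; split => //; apply: eW; rewrite (splitr e).
by apply: ball_triangle pn _; exact: ball_sym.
Qed.

End HausdorffLimit.

(** * Convergence along moving points *)

Section CvgAlong.
Context {K : realType} {B : pmetricType K}.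
Context {A_ : nat -> set B} {A : set B}.
Hypothesis cvgA : hausdorff_dist (A_ n) A @[n --> \oo] --> 0%E.
Hypothesis A_neq0 : forall n, exists x, A_ n x.
Context {g_ : forall n, A_ n -> A_ n -> K} {g : A -> A -> K}.
Arguments g_ : clear implicits.
Hypothesis cvg_g : cvg_along g_ g.

(** Otherwise there are indices n_ 0 < n_ 1 < ... and pairs of points of
    A_ (n_ k), within 1 / (k + 1) of x and y, where g_ stays at distance at least
    e from g x y.  Completing them by approximants of x and y at the other
    indices gives sequences that contradict the convergence along sequences. *)
Lemma cvg_along_uniform (x y : A) (e : K) : 0 < e ->
  exists2 d, 0 < d & \forall n \near \oo, forall x' y' : A_ n,
    ball (set_val x) d (set_val x') -> ball (set_val y) d (set_val y') ->
    `|g x y - g_ n x' y'| < e.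
Proof.
move=> e0; apply: contrapT => no_d.
pose bad k n (p : A_ n * A_ n) := [/\ ball (set_val x) k.+1%:R^-1 (set_val p.1),
  ball (set_val y) k.+1%:R^-1 (set_val p.2) & e <= `|g x y - g_ n p.1 p.2|].
have /choice[f fP] (kN : nat * nat) :
    exists n, (kN.2 <= n)%N /\ exists p : A_ n * A_ n, bad kN.1 n p.
  case: kN => k N /=; apply: contrapT => no_n; apply: no_d.
  exists k.+1%:R^-1; first by rewrite invr_gt0.
  exists N => // n /= Nn x' y' xx' yy'; rewrite ltNge; apply/negP => ge.
  by apply: no_n; exists n; split => //; exists (x', y').
(* f (k, N) is an index at least N that is bad at scale 1 / (k + 1). *)
pose n_ := fix n_ k := if k is k'.+1 then f (k, (n_ k').+1) else f (0, 0)%N.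
have n_bad k : exists p : A_ (n_ k) * A_ (n_ k), bad k (n_ k) p.
  by case: k => [|k]; [have [] := fP (0, 0)%N|have [] := fP (k.+1, (n_ k).+1)].
have n_lt k : (n_ k < n_ k.+1)%N by have [] := fP (k.+1, (n_ k).+1).
have n_mono : {mono n_ : i j / (i <= j)%N}
  by apply: leq_mono; apply: homo_ltn n_lt => i j k; exact: ltn_trans.
have n_ge k : (k <= n_ k)%N by elim: k => // k IH; exact: leq_ltn_trans IH (n_lt k).
have [phi phiP] := hausdorff_approx cvgA A_neq0.
have pick n : exists p : A_ n * A_ n, (forall k, n_ k = n -> bad k n p) /\
    ((forall k, n_ k <> n) -> p = (phi n x, phi n y)).
  have [[k nk]|no_k] := pselect (exists k, n_ k = n); last first.
    exists (phi n x, phi n y); split => // k nk; exfalso; apply: no_k.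
    by exists k.
  case: _ / nk; have [p pbad] := n_bad k; exists p; split => [j /eqP|/(_ k)//].
  by rewrite (inj_eq (incn_inj n_mono)) => /eqP ->.
pose p_ n := projT1 (cid (pick n)).
have p_bad k : bad k (n_ k) (p_ (n_ k)) by exact: (projT2 (cid (pick (n_ k)))).1.
have p_phi n : (forall k, n_ k <> n) -> p_ n = (phi n x, phi n y).
  exact: (projT2 (cid (pick n))).2.
have p_near (d : K) : 0 < d -> \forall n \near \oo,
    ball (set_val x) d (set_val (p_ n).1) /\ ball (set_val y) d (set_val (p_ n).2).
  move=> d0; have [k _ kd] := near_infty_natSinv_lt (PosNum d0).
  have near_phi z : \forall n \near \oo, ball (set_val z) d (set_val (phi n z)).
    exact: cvg_ball (phiP z) _ d0.
  apply: filterS3 (near_phi x) (near_phi y) (nbhs_infty_ge (n_ k)) => n xd yd kn.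
  have [[j nj]|no_k] := pselect (exists j, n_ j = n); last first.
    by rewrite p_phi//= => j nj; apply: no_k; exists j.
  have kj : (k <= j)%N by rewrite -n_mono nj.
  case: _ / nj; have [xj yj _] := p_bad j.
  have jd := ltW (kd _ kj).
  by split; [exact: le_ball xj|exact: le_ball yj].
have gcvg : g_ n (p_ n).1 (p_ n).2 @[n --> \oo] --> g x y.
  apply: cvg_g; apply/cvg_ballP => d d0; apply: filterS (p_near d d0) => n;
  by case.
have [N _ NP] := (cvgrPdist_lt _ _).1 gcvg _ e0.
have [_ _] := p_bad N; have := NP _ (n_ge N) => /=.
by rewrite ltNge => /negbTE ->.
Qed.

(** The hypothesis speaks of sequences that converge at infinity; local uniformity
    extends it to points that converge only along an ultrafilter. *)
Lemma cvg_along_ultra (U : set_system nat) (x_ y_ : forall n, A_ n) (x y : A) :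
  UltraFilter U -> \oo `<=` U ->
  set_val (x_ n) @[n --> U] --> (set_val x : B) ->
  set_val (y_ n) @[n --> U] --> (set_val y : B) ->
  g_ n (x_ n) (y_ n) @[n --> U] --> g x y.
Proof.
move=> UU ooU xx yy; apply/cvgrPdist_lt => e e0.
have [d d0 /ooU Ud] := cvg_along_uniform x y e0.
have Ux : \forall n \near U, ball (set_val x) d (set_val (x_ n)).
  exact: cvg_ball xx _ d0.
have Uy : \forall n \near U, ball (set_val y) d (set_val (y_ n)).
  exact: cvg_ball yy _ d0.
by apply: filterS3 Ud Ux Uy => n /(_ (x_ n) (y_ n)) + xn yn; apply.
Qed.

Lemma cvg_along_continuous : continuous (fun p : (A * A)%type => g p.1 p.2).
Proof.
move=> [x y]; apply/cvgrPdist_lt => e e0 /=.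
have e2 : 0 < e / 2 by rewrite divr_gt0.
have [d d0 Ud] := cvg_along_uniform x y e2.
have d2 : 0 < d / 2 by rewrite divr_gt0.
have [phi phiP] := hausdorff_approx cvgA A_neq0.
have near_x (z : A) : \forall z' \near z, ball (set_val z : B) (d / 2) (set_val z').
  exact: (@initial_continuous _ _ (set_val : A -> B) z) (nbhsx_ballx _ _ d2).
exists ([set z | ball (set_val x : B) (d / 2) (set_val z)],
        [set z | ball (set_val y : B) (d / 2) (set_val z)]).
  by split; exact: near_x.
move=> [x' y'] [/= xx' yy'].
have lim : g_ n (phi n x') (phi n y') @[n --> \oo] --> g x' y' by apply: cvg_g.
have : `|g x y - g x' y'| <= e / 2.
  have lim' : `|g x y - g_ n (phi n x') (phi n y')| @[n --> \oo]
      --> `|g x y - g x' y'|.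
    by apply: cvg_norm; apply: cvgB => //; exact: cvg_cst.
  have near_phi z : \forall n \near \oo, ball (set_val z) (d / 2) (set_val (phi n z)).
    exact: cvg_ball (phiP z) _ d2.
  apply: cvgr_to_le lim' _; apply: filterS3 Ud (near_phi x') (near_phi y') => n.
  move=> /(_ (phi n x') (phi n y')) Un xn yn.
  apply/ltW/Un; rewrite (splitr d).
    exact: ball_triangle xx' xn.
  exact: ball_triangle yy' yn.
by move/le_lt_trans; apply; rewrite ltr_pdivrMr// ltr_pMr// ltr1n.
Qed.

End CvgAlong.

(** * Limits of finite networks *)

Section Networks.
Context {K : realType}.

Lemma conductance_energy_ge0 (V : finType) (c : V -> V -> K) f :
  (forall x y, 0 <= c x y) -> 0 <= conductance_energy c f.
Proof.
move=> c0; rewrite /conductance_energy mulr_ge0 ?invr_ge0//.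
by do 2![apply: sumr_ge0 => ? _]; rewrite mulr_ge0// sqr_ge0.
Qed.

Lemma conductance_energy_affine (V : finType) (c : V -> V -> K) f a b :
  conductance_energy c (fun x => a * (f x - b)) = a ^+ 2 * conductance_energy c f.
Proof.
rewrite /conductance_energy mulrCA; congr (_ * _); rewrite mulr_sumr.
apply: eq_bigr => x _; rewrite mulr_sumr; apply: eq_bigr => y _; ring.
Qed.

Lemma conductance_energy_ge (V : finType) (c : V -> V -> K) f x y :
  (forall x y, 0 <= c x y) -> (forall x y, c x y = c y x) -> x != y ->
  c x y * (f x - f y) ^+ 2 <= conductance_energy c f.
Proof.
move=> c0 csym xy.
have t0 x' y' : 0 <= c x' y' * (f x' - f y') ^+ 2 by rewrite mulr_ge0// sqr_ge0.
(* The pair {x, y} occurs twice in the double sum, which offsets the factor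
   one half. *)
rewrite /conductance_energy (bigD1 x)//= (bigD1 y)//=.
rewrite [X in _ <= _ * (_ + X)](bigD1 y) 1?eq_sym//=.
rewrite [X in _ <= _ * (_ + (X + _))](bigD1 x) 1?eq_sym//=.
rewrite (csym y x) -(sqrrN (f y - f x)) opprB.
set u := c x y * _; set v := \sum_(i | _) _; set w := \sum_(i | _) _.
set z := \sum_(i | _) _.
have v0 : 0 <= v by apply: sumr_ge0 => i _; exact: t0.
have w0 : 0 <= w by apply: sumr_ge0 => i _; exact: t0.
have z0 : 0 <= z by apply: sumr_ge0 => i _; apply: sumr_ge0 => j _; exact: t0.
by move: u v w z v0 w0 z0 => u v w z; lra.
Qed.

Lemma conductance_energy_gt0 (V : finType) (c : V -> V -> K) f :
  is_conductance c -> ~ constant_fun f -> 0 < conductance_energy c f.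
Proof.
move=> cc nf; rewrite lt_neqAle conductance_energy_ge0 ?andbT; last first.
  exact: conductance_ge0 cc.
by rewrite eq_sym; apply/eqP => /(conductance_eq0 cc).
Qed.

Section Dipole.
Context {V : finType} {c : V -> V -> K} {x y : V}.
Hypothesis cc : is_conductance c.
Let S := resistance_ratios (conductance_energy c) [set: V -> K] x y.
Hypothesis r0 : 0 < sup S.

(** The supremum of an unbounded set is 0 by convention, so a positive value is a
    genuine supremum. *)
Let supS : has_sup S.
Proof. by apply: contrapT => /sup_out S0; move: r0; rewrite S0 ltxx. Qed.

Lemma network_oscillation f : (f x - f y) ^+ 2 <= sup S * conductance_energy c f.
Proof.
have [[k ->]|nf] := pselect (constant_fun f).
  rewrite subrr expr0n/=; apply: mulr_ge0; first exact: ltW.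
  by apply: conductance_energy_ge0; exact: conductance_ge0 cc.
rewrite -ler_pdivrMr; last exact: conductance_energy_gt0.
rewrite -real_normK ?num_real//.
by apply: ub_le_sup; [exact: supS.2|exists f].
Qed.

(** Near-optimal potentials with prescribed values at x and y; these values survive
    the passage to the limit, whereas ratios alone would not. *)
Lemma network_dipole d : 0 < d -> exists g : V -> K,
  [/\ g x = 1, g y = 0 & sup S * conductance_energy c g <= 1 + d].
Proof.
move=> d0; have d1 : 0 < 1 + d by rewrite ltr_wpDl.
have e0 : 0 < sup S - sup S / (1 + d).
  by rewrite subr_gt0 ltr_pdivrMr// ltr_pMr// ltrDl.
have [_ [f [_ nf] <-]] := sup_adherent e0 supS; rewrite opprB addrC subrK.
have E0 := conductance_energy_gt0 cc nf.
rewrite real_normK ?num_real// ltr_pdivlMr// mulrAC ltr_pdivrMr// => lt.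
have D0 : f x - f y != 0.
  apply: contraTneq lt => ->; rewrite expr0n/= !mul0r -leNgt.
  exact: mulr_ge0 (ltW r0) (ltW E0).
exists (fun z => (f x - f y)^-1 * (f z - f y)); split.
- by rewrite mulVf.
- by rewrite subrr mulr0.
rewrite conductance_energy_affine exprVn mulrCA mulrC ler_pdivrMr ?exprn_even_gt0//.
by rewrite [leRHS]mulrC ltW.
Qed.

End Dipole.

Section Pullback.
Context {V W : finType} (h : V -> W) (c : W -> W -> K).
Hypothesis bij_h : bijective h.
Let ch x y := c (h x) (h y).

Lemma conductance_energy_pullback f :
  conductance_energy ch (f \o h) = conductance_energy c f.
Proof.
have inj_h := bij_inj bij_h.
rewrite /conductance_energy (reindex h) /=; last exact: onW_bij.
congr (_ * _); apply: eq_bigr => x _; rewrite (reindex h) /=; last exact: onW_bij.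
by apply: eq_bigl => y; rewrite (inj_eq inj_h).
Qed.

Let pullback_surj (f : V -> K) : exists f', f = f' \o h.
Proof.
by have [k hk kh] := bij_h; exists (f \o k); apply/funext => x /=; rewrite hk.
Qed.

Let constant_pullback (f : W -> K) : constant_fun (f \o h) <-> constant_fun f.
Proof.
split=> [[a fa]|[a ->]]; exists a => //; have [k hk kh] := bij_h.
by apply/funext => x; rewrite -(kh x); exact: (congr1 (@^~ (k x)) fa).
Qed.

Lemma is_conductance_pullback : is_conductance c -> is_conductance ch.
Proof.
move=> cc; split=> [x y|x y|f].
- exact: conductance_ge0 cc _ _.
- exact: conductance_sym cc _ _.
- have [f' ->] := pullback_surj f; rewrite conductance_energy_pullback.
  by rewrite constant_pullback; exact: conductance_eq0 cc _.
Qed.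

Lemma resistance_ratios_pullback x y :
  resistance_ratios (conductance_energy ch) [set: V -> K] x y =
  resistance_ratios (conductance_energy c) [set: W -> K] (h x) (h y).
Proof.
apply/seteqP; split=> [_ [f [_ nf] <-]|_ [f [_ nf] <-]]; last first.
  exists (f \o h); last by rewrite conductance_energy_pullback.
  by split=> // /constant_pullback.
have [f' ff'] := pullback_surj f; rewrite ff' conductance_energy_pullback.
by exists f' => //; split => // /constant_pullback; rewrite -ff'.
Qed.

End Pullback.

Lemma resistance_ratios_xx (X : Type) (Q : (X -> K) -> K) F x :
  sup (resistance_ratios Q F x x) = 0.
Proof.
have [->|S0] := eqVneq (resistance_ratios Q F x x) set0; first exact: sup0.
rewrite (_ : resistance_ratios Q F x x = [set 0]) ?sup1//.
apply/seteqP; split=> [_ [f _ <-]|_ ->]; first by rewrite subrr normr0 expr0n mul0r.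
by move/set0P: S0 => [_ [f Ff _]]; exists f => //; rewrite subrr normr0 expr0n mul0r.
Qed.

Lemma resistance_metric_xx (X : choiceType) (R : X -> X -> K) x :
  resistance_metric R -> R x x = 0.
Proof.
move=> /(_ [fset x]%fset)[c _ cE].
have xV : x \in [fset x]%fset by rewrite inE.
by have := cE [` xV]%fset [` xV]%fset; rewrite resistance_ratios_xx.
Qed.

(** Approximating a finite set V by points phi v of another space transports the
    network from the image of V back to V, so that all networks of a sequence
    live on the same vertex set. *)
Lemma resistance_metric_pullback (X Y : choiceType) (R : X -> X -> K)
    (V : {fset Y}) (phi : Y -> X) : resistance_metric R ->
  {in V &, injective phi} -> exists2 c : V -> V -> K, is_conductance c &
    forall x y : V, R (phi (fsval x)) (phi (fsval y)) =
      sup (resistance_ratios (conductance_energy c) [set: V -> K] x y).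
Proof.
move=> rR inj; pose W := [fset phi v | v in V]%fset; have [c cc cE] := rR W.
have hW (v : V) : phi (fsval v) \in W.
  by apply/imfsetP; exists (fsval v) => //; exact: fsvalP.
pose h (v : V) : W := [` hW v]%fset.
have bij_h : bijective h.
  apply: inj_card_bij.
    move=> u v /(congr1 val) /= uv; apply: val_inj; apply: inj uv; exact: fsvalP.
  by rewrite -!cardfE (leq_trans (leq_imfset_card _ _ _)).
exists (fun x y => c (h x) (h y)); first exact: (is_conductance_pullback bij_h cc).
by move=> x y; rewrite resistance_ratios_pullback// -cE.
Qed.

End Networks.

Lemma cvg_conductance_energy (K : realType) (I : Type) (U : set_system I)
    (V : finType) (c_ : I -> V -> V -> K) (c : V -> V -> K) (f_ : I -> V -> K)
    (f : V -> K) : Filter U ->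
  (forall x y, x != y -> c_ n x y @[n --> U] --> c x y) ->
  (forall x, f_ n x @[n --> U] --> f x) ->
  conductance_energy (c_ n) (f_ n) @[n --> U] --> conductance_energy c f.
Proof.
move=> UF cc cf; apply: cvgM; first exact: cvg_cst.
apply: cvg_big => [|x _]; first exact: add_continuous.
apply: cvg_big => [|y xy]; first exact: add_continuous.
by apply: cvgM; [exact: cc|]; apply: cvgM; apply: cvgB.
Qed.

Lemma bounded_ultra_cvg (K : realType) (I : Type) (U : set_system I)
    (u : I -> K) (M : K) : UltraFilter U ->
  (\forall n \near U, `|u n| <= M) -> exists l : K, u n @[n --> U] --> l.
Proof.
move=> UU uM.
have [|l _ ul] := ultra_compact_cvg UU (@segment_compact K (- M) M) (u := u).
  by apply: filterS uM => n; rewrite /= in_itv /= ler_norml.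
by exists l.
Qed.

(** Dipole potentials bound the conductances by c x y <= 4 / r x y, and their values
    are bounded by the oscillation estimate, so both have limits along U.  The
    oscillation estimate in the limit gives one inequality between r and the
    resistance of the limit network, and also shows that a function of zero
    energy is constant; the limits of the dipoles give the other inequality. *)
Lemma network_ultralimit (K : realType) (V : finType) (U : set_system nat)
    (c_ : nat -> V -> V -> K) (r : V -> V -> K) :
  UltraFilter U -> \oo `<=` U ->
  (\forall n \near U, is_conductance (c_ n)) ->
  (forall x y, sup (resistance_ratios (conductance_energy (c_ n)) [set: V -> K] x y)
     @[n --> U] --> r x y) ->
  (forall x y, x != y -> 0 < r x y) ->
  exists2 c, is_conductance c &
    forall x y, r x y = sup (resistance_ratios (conductance_energy c) [set: V -> K] x y).
Proof.
move=> UU ooU Uc cr r0.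
pose r_ n x y := sup (resistance_ratios (conductance_energy (c_ n)) [set: V -> K] x y).
have Ur x y : x != y -> \forall n \near U, [/\ is_conductance (c_ n),
    0 < r_ n x y, r x y / 2 < r_ n x y & r_ n x y < r x y + 1].
  move=> xy; have r0' := r0 _ _ xy.
  have lt2 : r x y / 2 < r x y by rewrite ltr_pdivrMr// ltr_pMr// ltr1n.
  have lt1 : r x y < r x y + 1 by rewrite ltrDl.
  apply: filterS3 Uc (cvgr_gt _ (cr x y) _ lt2) (cvgr_lt _ (cr x y) _ lt1).
  by move=> n ? r1 ?; split => //; apply: lt_trans r1; exact: divr_gt0.
have /choice[g_ gP] (k : nat * (V * V)) : exists g : V -> K,
    is_conductance (c_ k.1) -> 0 < r_ k.1 k.2.1 k.2.2 ->
    [/\ g k.2.1 = 1, g k.2.2 = 0 &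
      r_ k.1 k.2.1 k.2.2 * conductance_energy (c_ k.1) g <= 1 + k.1.+1%:R^-1].
  case: k => n [x y] /=.
  have [[cn rn]|nc] := pselect (is_conductance (c_ n) /\ 0 < r_ n x y); last first.
    by exists (cst 0) => ? ?; exfalso; apply: nc.
  have n0 : 0 < n.+1%:R^-1 :> K by rewrite invr_gt0.
  by have [g gn] := network_dipole cn rn n0; exists g.
have energy_bound x y : x != y -> \forall n \near U,
    conductance_energy (c_ n) (g_ (n, (x, y))) <= 4 / r x y.
  move=> xy; apply: filterS (Ur _ _ xy) => n [cn rn rn2 _].
  have [_ _] := gP (n, (x, y)) cn rn => /=.
  have n1 : n.+1%:R^-1 <= 1 :> K by rewrite invf_le1// ler1n.
  have r0' := r0 _ _ xy; move: (conductance_energy _ _) => e re.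
  rewrite ler_pdivlMr//; move: rn2 re; rewrite -/(r_ n x y).
  move: (r_ n x y) (r x y) n.+1%:R^-1 r0' n1 => a b d b0 d1 ab ae.
  by have [e0|e0] := leP 0 e; nra.
have /choice[c0 c0P] (p : V * V) : exists l : K, p.1 != p.2 ->
    c_ n p.1 p.2 @[n --> U] --> l.
  case: p => x y /=; have [xy|nxy] := eqVneq x y; first by exists 0.
  have [|l cl] := @bounded_ultra_cvg K _ U (fun n => c_ n x y) (4 / r x y) UU.
    apply: filterS2 (Ur _ _ nxy) (energy_bound _ _ nxy) => n [cn rn _ _].
    rewrite ger0_norm; last exact: conductance_ge0 cn _ _.
    apply: le_trans; have [gx gy _] := gP (n, (x, y)) cn rn.
    have := conductance_energy_ge (g_ (n, (x, y))) (conductance_ge0 cn)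
      (conductance_sym cn) nxy.
    by rewrite gx gy subr0 expr1n mulr1.
  by exists l.
(* The energy does not see the diagonal of c_ n, which may diverge; 0 is an
   arbitrary value. *)
pose c x y := if x == y then 0 else c0 (x, y).
have cvg_c x y : x != y -> c_ n x y @[n --> U] --> c x y.
  by move=> xy; rewrite /c (negPf xy); exact: c0P (x, y) xy.
have c_ge0 x y : 0 <= c x y.
  have [->|xy] := eqVneq x y; first by rewrite /c eqxx.
  apply: cvgr_to_ge (cvg_c _ _ xy) _; apply: filterS Uc => n cn.
  exact: conductance_ge0 cn _ _.
have c_le x y : x != y -> c x y <= c y x.
  move=> xy; have yx : y != x by rewrite eq_sym.
  apply: ler_cvg_to (cvg_c _ _ xy) (cvg_c _ _ yx) _; apply: filterS Uc => n cn.
  by rewrite (conductance_sym cn).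
have c_sym x y : c x y = c y x.
  have [->//|xy] := eqVneq x y; apply/eqP; rewrite eq_le !c_le//.
  by rewrite eq_sym.
have c_osc f x y : x != y -> (f x - f y) ^+ 2 <= r x y * conductance_energy c f.
  move=> xy.
  have Ecvg : conductance_energy (c_ n) f @[n --> U] --> conductance_energy c f.
    by apply: cvg_conductance_energy => // z; exact: cvg_cst.
  apply: cvgr_to_ge (cvgM (cr x y) Ecvg) _; apply: filterS (Ur _ _ xy) => n.
  by move=> [cn rn _ _]; exact: network_oscillation.
have cc : is_conductance c.
  split => // f; split=> [f0|[k ->]]; last first.
    by rewrite /conductance_energy !big1 ?mulr0// => x _; rewrite big1// => y _;
       rewrite subrr expr0n mulr0.
  have fE x y : f x = f y.
    have [->//|xy] := eqVneq x y; apply/eqP; rewrite -subr_eq0 -sqrf_eq0.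
    by rewrite eq_le sqr_ge0 andbT (le_trans (c_osc f x y xy))// f0 mulr0.
  have [x _|V0] := pickP [pred x : V | true].
    by exists (f x); apply/funext => y; exact: fE.
  by exists 0; apply/funext => y; have := V0 y.
have cvg_dipole x y : x != y -> exists g : V -> K,
    [/\ g x = 1, g y = 0 & r x y * conductance_energy c g <= 1].
  move=> xy; have r0' := r0 _ _ xy.
  have /choice[g cvg_g] z : exists l : K, g_ (n, (x, y)) z @[n --> U] --> l.
    have [->|zy] := eqVneq z y.
      exists 0; apply: cvg_near_cst; apply: filterS (Ur _ _ xy) => n [cn rn _ _].
      by have [] := gP (n, (x, y)) cn rn.
    apply: (@bounded_ultra_cvg _ _ _ _ (1 + (r z y + 1) * (4 / r x y)) UU).
    apply: filterS3 (Ur _ _ xy) (Ur _ _ zy) (energy_bound _ _ xy) => n.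
    move=> [cn rn _ _] [_ rzn _ rz] eb; have [_ gy _] := gP (n, (x, y)) cn rn.
    have := network_oscillation cn rzn (g_ (n, (x, y))); rewrite gy subr0 -/(r_ _ _ _).
    move: (g_ _ z) => a.
    have : r_ n z y * conductance_energy (c_ n) (g_ (n, (x, y))) <=
        (r z y + 1) * (4 / r x y).
      apply: ler_pM => //; [exact: ltW| |exact: ltW].
      exact: conductance_energy_ge0 (conductance_ge0 cn).
    move=> h1 h2; have := le_trans h2 h1; move: (_ * _) => M aM.
    rewrite ler_norml; have := sqr_ge0 (a - 1); have := sqr_ge0 (a + 1).
    by move=> *; apply/andP; split; nra.
  exists g; split.
  - apply: (cvg_unique _ (cvg_g x)) => //.
    apply: cvg_near_cst; apply: filterS (Ur _ _ xy) => n [cn rn _ _].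
    by have [] := gP (n, (x, y)) cn rn.
  - apply: (cvg_unique _ (cvg_g y)) => //.
    apply: cvg_near_cst; apply: filterS (Ur _ _ xy) => n [cn rn _ _].
    by have [] := gP (n, (x, y)) cn rn.
  - have Ecvg := cvg_conductance_energy _ cvg_c cvg_g.
    have cvg1 : 1 + n.+1%:R^-1 @[n --> U] --> (1 : K).
      rewrite -[X in _ --> X]addr0; apply: cvgD; first exact: cvg_cst.
      by apply: (cvg_trans _ (@cvg_harmonic K)) => W; apply: ooU.
    apply: ler_cvg_to (cvgM (cr x y) (Ecvg _)) cvg1 _.
    apply: filterS (Ur _ _ xy) => n [cn rn _ _].
    by have [] := gP (n, (x, y)) cn rn.
exists c => // x y; have [->|xy] := eqVneq x y.
  rewrite resistance_ratios_xx; apply: (cvg_unique _ (cr y y)) => //.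
  by apply: cvg_near_cst; apply: nearW => n; exact: resistance_ratios_xx.
have [g [gx gy gE]] := cvg_dipole x y xy.
have ng : ~ constant_fun g.
  by move=> [k gk]; move: gx gy; rewrite gk /cst => -> /eqP; rewrite oner_eq0.
have Eg := conductance_energy_gt0 cc ng.
have ubS : ubound (resistance_ratios (conductance_energy c) [set: V -> K] x y) (r x y).
  move=> _ [f [_ nf] <-]; rewrite ler_pdivrMr; last exact: conductance_energy_gt0.
  by rewrite real_normK ?num_real//; exact: c_osc.
apply/eqP; rewrite eq_le; apply/andP; split; last first.
  by apply: ge_sup => //; exists (`|g x - g y| ^+ 2 / conductance_energy c g), g.
apply: (@le_trans _ _ (`|g x - g y| ^+ 2 / conductance_energy c g)).
  by rewrite ler_pdivlMr// gx gy subr0 normr1 expr1n.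
by apply: ub_le_sup; [exists (r x y)|exists g].
Qed.

(** R is positive off the diagonal, which makes the approximation of a finite set
    injective for almost all indices and the limit resistances nonzero. *)
Lemma resistance_metric_limit (K : realType) (B : pmetricType K)
    (A_ : nat -> set B) (A : set B)
    (R_ : forall n, A_ n -> A_ n -> K) (R : A -> A -> K) :
  hausdorff_dist (A_ n) A @[n --> \oo] --> 0%E ->
  (forall n, exists x, A_ n x) ->
  (forall n, resistance_metric (R_ n)) -> is_metric R -> cvg_along R_ R ->
  resistance_metric R.
Proof.
move=> cvgA A_neq0 rR_ mR cvgR V.
have [phi phiP] := hausdorff_approx cvgA A_neq0.
have [U [UU ooU]] := ultraFilterLemma (F := \oo) _.
have R_gt0 x y : x != y -> 0 < R x y.
  move=> xy; have R0 : R x y != 0 by apply: contra_neq xy; exact: metric_eq0 mR _ _.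
  rewrite lt_neqAle eq_sym R0/=.
  have := metric_triangular mR x y x; rewrite (metric_xx mR).
  by rewrite (metric_symmetric mR y x); lra.
have UR (x y : A) : R_ n (phi n x) (phi n y) @[n --> U] --> R x y.
  by move=> W /(cvgR _ _ _ _ (phiP x) (phiP y)); exact: ooU.
have phi_inj : \forall n \near U, {in V &, injective (phi n)}.
  have : \forall n \near U, forall p : V * V,
      phi n (fsval p.1) = phi n (fsval p.2) -> p.1 = p.2.
    apply: filter_forall => -[x y] /=; have [->|xy] := eqVneq x y.
      exact: filterE.
    apply: filterS (cvgr_gt _ (UR (fsval x) (fsval y)) _ (R_gt0 _ _ xy)) => n.
    by move=> + xyn; rewrite xyn (resistance_metric_xx _ (rR_ n)) ltxx.
  apply: filterS => n inj x y xV yV xy.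
  exact: (congr1 val (inj ([` xV]%fset, [` yV]%fset) xy)).
have /choice[c_ c_P] n : exists c : V -> V -> K, {in V &, injective (phi n)} ->
    is_conductance c /\ forall x y : V, R_ n (phi n (fsval x)) (phi n (fsval y)) =
      sup (resistance_ratios (conductance_energy c) [set: V -> K] x y).
  have [inj|ninj] := pselect {in V &, injective (phi n)}; last first.
    by exists (fun _ _ => 0) => /ninj.
  by have [c cc cE] := resistance_metric_pullback (rR_ n) inj; exists c.
apply: (@network_ultralimit K V U c_ (fun x y => R (fsval x) (fsval y)) UU ooU).
- by apply: filterS phi_inj => n /c_P[].
- move=> x y; apply: cvg_trans (UR (fsval x) (fsval y)).
  apply: near_eq_cvg; apply: filterS phi_inj => n /c_P[_ cE].
  by rewrite cE.
- by move=> x y xy; apply: R_gt0.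
Qed.

(** * Averages over the support of a measure *)

Lemma valL_set_val (T V : Type) (v : V) (A : set T) (f : A -> V) (a : A) :
  'valL_v f (set_val a) = f a.
Proof. exact: (congr1 (@^~ a) (valLK v f)). Qed.

Lemma continuous_linear_comb (K : realType) (T : topologicalType) a (f g : T -> K) :
  continuous f -> continuous g -> continuous (a \*o f \+ g).
Proof.
move=> cf cg z; apply: cvgD; last exact: cg.
by apply: cvgM; [exact: cvg_cst|exact: cf].
Qed.

Section CompactBorel.
Context {K : realType} {B : pmetricType K}.
Hypothesis compactB : compact [set: B].

Lemma open_borel (U : set B) : open U -> measurable (U : set (borelType B)).
Proof. by move=> oU; exact: sub_sigma_algebra. Qed.

Lemma closed_borel (C : set B) : closed C -> measurable (C : set (borelType B)).
Proof. by rewrite -openC => /open_borel/measurableC; rewrite setCK. Qed.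

Lemma continuous_borel (f : B -> K) :
  continuous f -> measurable_fun [set: borelType B] f.
Proof.
move=> /continuousP cf; apply: (measurability _ (RGenOpens.measurableE K)).
move=> _ [_ [a [b ->]] <-]; rewrite setTI; apply: open_borel.
exact/cf/interval_open.
Qed.

Lemma continuous_integrable (mu : probability (borelType B) K)
    (D : set (borelType B)) (f : B -> K) : measurable D -> continuous f ->
  mu.-integrable D (EFin \o f).
Proof.
move=> mD cf; apply: measurable_bounded_integrable => //.
- by rewrite (le_lt_trans (probability_le1 mu mD))// ltry.
- exact: measurable_funS (continuous_borel cf).
have /compact_bounded[M [Mr Mf]] : compact (f @` [set: B]).
  by apply: continuous_compact => //; exact: continuous_subspaceT.
by exists M; split => // x Mx y _; apply: (Mf x Mx); exists y.
Qed.

(** The complement of the support is a union of null open sets, which can be chosen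
    in a countable basis of the compact metric space. *)
Lemma measure_support_full (mu : probability (borelType B) K) (A : set B) :
  closed A -> measure_support mu = A -> mu A = 1%E.
Proof.
move=> clA suppA; have mA : measurable (A : set (borelType B)) := closed_borel clA.
suff : mu (~` A) = 0%E.
  have := probability_setC mu (measurableC mA); rewrite setCK => -> ->.
  by rewrite sube0.
have [V cV [Vo Vb]] := compact_second_countable compactB.
have /pcard_geP[f] := cV.
pose F n : set (borelType B) :=
  if `[< open (f n : set B) /\ mu (f n) = 0%E >] then f n else set0.
have : mu.-negligible (\bigcup_k F k).
  apply: negligible_bigcup => k; rewrite /F; case: asboolP => [[ok k0]|_].
    by apply/negligibleP => //; exact: open_borel.
  exact: negligible_set0.
suff -> : \bigcup_k F k = ~` A by move/negligibleP => -> //; exact: measurableC.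
apply/seteqP; split=> [x [n _]|x nAx].
  rewrite /F; case: asboolP => // -[on n0] fx; rewrite /setC /= -suppA => /(_ _ on fx).
  by rewrite n0 ltxx.
have [U [oU Ux U0]] : exists U : set B, [/\ open U, U x & mu U = 0%E].
  apply: contrapT => noU; apply: nAx; rewrite -suppA => U oU Ux.
  rewrite lt_neqAle measure_ge0 andbT eq_sym; apply/eqP => U0.
  by apply: noU; exists U.
have [W [VW Wx] WU] := Vb x _ (open_nbhs_nbhs (conj oU Ux)).
have [n _ nW] := 'surj_f VW; have oW := Vo _ VW.
exists n => //; rewrite /F nW; case: asboolP => // -[]; split => //.
apply/eqP; rewrite eq_le measure_ge0 andbT -U0.
by apply: le_measure => //; rewrite inE; exact: open_borel.
Qed.

(** Tietze extension; it replaces functions on A by continuous functions on the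
    whole space, for which measurability and weak convergence are at hand. *)
Lemma compact_continuous_extension (A : set B) (f : A -> K) : closed A ->
  continuous f -> exists2 h : B -> K, continuous h & forall a : A, h (set_val a) = f a.
Proof.
move=> clA cf; have cA : compact A by apply: subclosed_compact clA compactB _.
have cvf : {within A, continuous ('valL_0 f)} by exact/subspace_valL_continuousP'.
have /compact_bounded[M [Mr Mf]] : compact ('valL_0 f @` A).
  exact: continuous_compact.
have M0 : 0 < `|M| + 1 by rewrite ltr_wpDl.
have [|h [hf ch _]] := continuous_bounded_extension (@pseudometric_normal K B)
    clA M0 cvf.
  by move=> x Ax; apply: (Mf (`|M| + 1)); [rewrite ltr_pwDr// ler_norm|exists x].
exists h => // a; rewrite -hf ?valL_set_val//; exact: valP.
Qed.

End CompactBorel.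

Section Average.
Context {K : realType} {B : pmetricType K}.
Hypothesis compactB : compact [set: B].

Definition average (mu : probability (borelType B) K) {A : set B} (f : A -> K) : K :=
  \int[mu]_(z in A) ('valL_0 f z).

Lemma average_extension (mu : probability (borelType B) K) (A : set B)
    (f : A -> K) (h : B -> K) : closed A -> mu A = 1%E -> continuous h ->
  (forall a : A, h (set_val a) = f a) -> average mu f = \int[mu]_z h z.
Proof.
move=> clA muA ch hf; have mA := closed_borel clA.
have mC := measurableC mA.
rewrite -(setUv A) Rintegral_setU//; last 2 first.
- by apply: continuous_integrable => //; exact: measurableU.
- by apply/disj_set2P; rewrite setICr.
rewrite [X in _ = _ + X](_ : _ = 0) ?addr0; last first.
  have mh : measurable_fun (~` A : set (borelType B)) (EFin \o h).
    by apply/measurable_EFinP; apply: measurable_funS (continuous_borel ch).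
  rewrite /Rintegral null_set_integral//; apply: etrans (probability_setC mu mA) _.
  by rewrite muA subee.
apply: eq_Rintegral => z zA.
by rewrite -[z]/(set_val (SigSub zA : A)) hf valL_set_val.
Qed.

Section Linear.
Context {mu : probability (borelType B) K} {A : set B}.
Hypotheses (clA : closed A) (muA : mu A = 1%E).

Lemma average_linear a (f g : A -> K) : continuous f -> continuous g ->
  average mu (a \*o f \+ g) = a * average mu f + average mu g.
Proof.
move=> cf cg; have [hf chf fE] := compact_continuous_extension compactB clA cf.
have [hg chg gE] := compact_continuous_extension compactB clA cg.
have caf : continuous (fun z => a * hf z).
  by move=> z; apply: cvgM; [exact: cvg_cst|exact: chf].
rewrite (average_extension clA muA chf fE) (average_extension clA muA chg gE).
rewrite (@average_extension _ _ _ (fun z => a * hf z + hg z))//.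
- by rewrite RintegralD ?RintegralZl//; exact: continuous_integrable.
- by move=> z; apply: cvgD; [exact: caf|exact: chg].
- by move=> z; rewrite /= fE gE.
Qed.

Lemma average_cst c : average mu (cst c : A -> K) = c.
Proof.
rewrite (@average_extension _ _ _ (cst c))//; last exact: cst_continuous.
rewrite /= Rintegral_cst// [X in fine X](_ : _ = 1%E) ?mulr1//.
exact: probability_setT.
Qed.

Lemma average_ge0 (f : A -> K) : (forall a, 0 <= f a) -> 0 <= average mu f.
Proof.
move=> f0; apply: Rintegral_ge0 => z Az.
by rewrite -[z]/(set_val (SigSub (mem_set Az) : A)) valL_set_val.
Qed.

Lemma average_le (f : A -> K) (M : K) : continuous f -> (forall a, `|f a| <= M) ->
  `|average mu f| <= M.
Proof.
move=> cf fM; have cM : continuous (cst M : A -> K) by exact: cst_continuous.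
have h1 : 0 <= average mu ((-1) \*o f \+ cst M).
  by apply: average_ge0 => a /=; have := fM a; rewrite ler_norml => /andP[]; lra.
have h2 : 0 <= average mu (1 \*o f \+ cst M).
  by apply: average_ge0 => a /=; have := fM a; rewrite ler_norml => /andP[]; lra.
rewrite !average_linear// average_cst in h1 h2; rewrite ler_norml.
by apply/andP; split; lra.
Qed.

End Linear.

(** If f_ n tends to f along points and h extends f to the whole space, then
    f_ n - h tends to 0 uniformly on A_ n along U, by compactness; the averages of
    h converge by weak convergence. *)
Lemma average_ultralimit (U : set_system nat) (A_ : nat -> set B) (A : set B)
    (mu_ : nat -> probability (borelType B) K) (mu : probability (borelType B) K)
    (f_ : forall n, A_ n -> K) (f : A -> K) :
  UltraFilter U -> \oo `<=` U -> hausdorff_dist (A_ n) A @[n --> \oo] --> 0%E ->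
  (forall n, exists x, A_ n x) -> (forall n, closed (A_ n)) -> closed A ->
  (forall n, mu_ n (A_ n) = 1%E) -> mu A = 1%E -> weak_cvg mu_ mu ->
  (forall n, continuous (f_ n)) -> continuous f ->
  (forall (p_ : forall n, A_ n) (p : A),
    set_val (p_ n) @[n --> U] --> (set_val p : B) -> f_ n (p_ n) @[n --> U] --> f p) ->
  average (mu_ n) (f_ n) @[n --> U] --> average mu f.
Proof.
move=> UU ooU cvgA A_neq0 clA_ clA muA_ muA cvg_mu cf_ cf f_f.
have [h ch hf] := compact_continuous_extension compactB clA cf.
have chA n : continuous (h \o set_val : A_ n -> K).
  by move=> z; apply: continuous_comp; [exact: initial_continuous|exact: ch].
pose d_ n := (-1) \*o (h \o set_val) \+ f_ n : A_ n -> K.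
have cd_ n : continuous (d_ n) := continuous_linear_comb (chA n) (cf_ n).
have avg_h : average (mu_ n) (h \o set_val : A_ n -> K) @[n --> U] --> average mu f.
  rewrite (average_extension clA muA ch hf).
  have -> : (fun n => average (mu_ n) (h \o set_val : A_ n -> K)) =
      (fun n => \int[mu_ n]_z h z).
    by apply/funext => n; exact: (average_extension (clA_ n) (muA_ n) ch (fun=> erefl)).
  by move=> W /(cvg_mu _ ch); exact: ooU.
have d_small (e : K) : 0 < e -> \forall n \near U, forall z, `|d_ n z| <= e.
  move=> e0; apply: filter_selection => [n|p_].
    by have [x Ax] := cid (A_neq0 n); exact: SigSub (mem_set Ax).
  have [p pp] := hausdorff_ultra_limit cvgA p_ compactB clA UU ooU.
  have hp : h (set_val (p_ n)) @[n --> U] --> f p.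
    by rewrite -hf; apply: continuous_cvg => //; exact: ch.
  have fh : f_ n (p_ n) - h (set_val (p_ n)) @[n --> U] --> (0 : K).
    by rewrite -(subrr (f p)); apply: cvgB => //; exact: f_f.
  move/cvgr0Pnorm_le: fh => /(_ e e0); apply: filterS => n.
  by rewrite /d_ /= mulN1r addrC.
have d0 : average (mu_ n) (d_ n) @[n --> U] --> (0 : K).
  apply/cvgr0Pnorm_le => e e0; apply: filterS (d_small e e0) => n.
  exact: average_le.
have -> : (fun n => average (mu_ n) (f_ n)) = (fun n => average (mu_ n) (d_ n) +
    average (mu_ n) (h \o set_val : A_ n -> K)).
  apply/funext => n; rewrite average_linear//; ring.
by rewrite -[X in _ --> X]add0r; exact: cvgD.
Qed.

End Average.

(** * The resolvent equation in terms of the resistance *)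

Section Continuity.
Context {K : realType} {T : topologicalType}.

Lemma continuousM_fun (f g : T -> K) :
  continuous f -> continuous g -> continuous (f \* g).
Proof. by move=> cf cg z; apply: cvgM; [exact: cf|exact: cg]. Qed.

Context {R : T -> T -> K}.
Hypothesis cR : continuous (fun p : T * T => R p.1 p.2).

Lemma continuous_slice x : continuous (R x).
Proof.
move=> y.
apply: (@continuous_comp _ _ _ (fun z => (x, z)) (fun p : T * T => R p.1 p.2)).
  by apply: cvg_pair; [exact: cvg_cst|exact: cvg_id].
exact: cR.
Qed.

Lemma continuous_slicel x : continuous (R ^~ x).
Proof.
move=> y.
apply: (@continuous_comp _ _ _ (fun z => (z, x)) (fun p : T * T => R p.1 p.2)).
  by apply: cvg_pair; [exact: cvg_id|exact: cvg_cst].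
exact: cR.
Qed.

Lemma continuous_green o x : continuous (green R o x).
Proof.
move=> y; apply: cvgM; first exact: cvg_cst.
apply: cvgB; last exact: continuous_slice.
by apply: cvgD; [exact: cvg_cst|exact: continuous_slicel].
Qed.

Lemma resistance_modulus_continuous (f : T -> K) C : (forall x, R x x = 0) ->
  (forall x y, (f x - f y) ^+ 2 <= R x y * C) -> continuous f.
Proof.
move=> Rxx fC x; apply/cvgrPdist_lt => e e0.
have C1 : 0 < `|C| + 1 by rewrite ltr_wpDl.
have e1 : 0 < e ^+ 2 / (`|C| + 1) by rewrite divr_gt0// exprn_gt0.
have /cvgrPdist_lt/(_ _ e1) := @continuous_slice x x.
apply: filterS => y; rewrite Rxx sub0r normrN ltr_pdivlMr// => lt.
rewrite -(ltr_pXn2r (n := 2))// ?nnegrE ?ltW// real_normK ?num_real//.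
apply: le_lt_trans _ lt; apply: le_trans (fC x y) _.
by rewrite (le_trans (ler_norm _))// normrM ler_wpM2l// lerDl.
Qed.

End Continuity.

Section Resolvent.
Context {K : realType} {B : pmetricType K} {A : set B}.
Context {mu : probability (borelType B) K} {R : A -> A -> K}.
Hypotheses (compactB : compact [set: B]) (clA : closed A) (muA : mu A = 1%E).
Hypothesis Rxx : forall x, R x x = 0.
Hypothesis cR : continuous (fun p : (A * A)%type => R p.1 p.2).

Lemma continuous_bounded (f : A -> K) : continuous f ->
  exists M, forall a, `|f a| <= M.
Proof.
move=> cf; have [h ch hf] := compact_continuous_extension compactB clA cf.
have /compact_bounded[M [Mr Mf]] : compact (h @` [set: B]).
  by apply: continuous_compact => //; exact: continuous_subspaceT.
exists (`|M| + 1) => a; rewrite -hf; apply: (Mf (`|M| + 1)); last by exists (set_val a).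
by rewrite ltr_pwDr// ler_norm.
Qed.

Lemma form_alphaE alpha (E : (A -> K) -> (A -> K) -> K) f g :
  form_alpha mu alpha E f g = E f g + alpha * average mu (f \* g).
Proof.
rewrite /form_alpha; congr (_ + _ * _); apply: eq_Rintegral => z zA.
by rewrite -[z]/(set_val (SigSub zA : A)) !valL_set_val.
Qed.

Section Kernel.
Context {E : (A -> K) -> (A -> K) -> K} {F : set (A -> K)}.
Hypothesis rf : resistance_form E F.
Hypothesis RE : forall p q : A, p != q ->
  sup (resistance_ratios (fun f => E f f) F p q) = R p q.
Context {alpha : K} {x : A} {u : A -> K}.
Hypotheses (alpha0 : 0 < alpha) (Fu : F u).
Hypothesis uE : forall f, F f -> E u f + alpha * average mu (u \* f) = f x.

Let c_rf f : F f -> continuous f.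
Proof.
by move=> Ff; apply: (resistance_modulus_continuous cR (C := E f f) Rxx) => y z;
  exact: (rf_oscillation rf Rxx RE).
Qed.

Lemma resolvent_mean : alpha * average mu u = 1.
Proof.
have F1 := rf_cst rf (1 : K); rewrite -[RHS]/((cst 1 : A -> K) x) -uE//.
rewrite (rf_sym rf Fu F1) (rf_cstl rf _ Fu) add0r.
by congr (_ * average mu _); apply/funext => z /=; rewrite mulr1.
Qed.

Lemma green_pole y : green R x y x = 0.
Proof. by rewrite /green Rxx addr0 subrr mulr0. Qed.

(** The resolvent equation tested with green R x y, which vanishes at x.  The form
    has disappeared from the result. *)
Lemma resolvent_green y : u y = u x - alpha * average mu (u \* green R x y).
Proof.
have [Fg gE] := rf_green rf Rxx RE x y.
have := uE Fg; rewrite green_pole (rf_sym rf Fu Fg) gE//; lra.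
Qed.

Lemma resolvent_energy : E u u <= u x.
Proof.
have := uE Fu; have : 0 <= average mu (u \* u).
  by apply: average_ge0 => z /=; rewrite -expr2 sqr_ge0.
have := alpha0; move: (average mu _) (E u u) (u x) => a b c; nra.
Qed.

Lemma resolvent_oscillation y z : (u y - u z) ^+ 2 <= R y z * u x.
Proof.
apply: le_trans (rf_oscillation rf Rxx RE y z Fu) _.
by rewrite ler_wpM2l ?resolvent_energy//; exact: (rf_resistance_ge0 rf Rxx RE).
Qed.

(** The oscillation bound and 4 D (u x) <= (D + u x)^2 give u z >= (u x - D) / 2 for all
    z, and the mean of u is 1 / alpha. *)
Lemma resolvent_bound D : (forall z, R x z <= D) -> u x <= 2 / alpha + D.
Proof.
move=> RD; have ux0 : 0 <= u x := le_trans (rf_ge0 rf Fu) resolvent_energy.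
have D0 : 0 <= D by rewrite -(Rxx x).
pose b := (u x - D) / 2.
have ub z : b <= u z.
  have := resolvent_oscillation x z.
  have : R x z * u x <= D * u x by rewrite ler_wpM2r.
  rewrite /b; move: (u x) (u z) (R x z) ux0 => p q r p0 h1 h2.
  rewrite ler_pdivrMr//; apply/negPn/negP; rewrite -ltNge => lt.
  have t1 : (p + D) / 2 < p - q by lra.
  have t2 : ((p + D) / 2) ^+ 2 < (p - q) ^+ 2 by rewrite ltr_pXn2r// nnegrE; lra.
  by have := sqr_ge0 (p - D); nra.
have c1 : continuous (cst (- b) : A -> K) by exact: cst_continuous.
have : 0 <= average mu (1 \*o u \+ cst (- b)).
  by apply: average_ge0 => z /=; rewrite mul1r subr_ge0.
rewrite average_linear// ?average_cst//; last exact: c_rf.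
have := resolvent_mean; have := alpha0; rewrite /b.
move: (average mu u) (u x) => a p al0 ala; have -> : a = alpha^-1.
  by rewrite -[LHS](mulKf (lt0r_neq0 al0)) ala mulr1.
lra.
Qed.

(** Let eta represent f |-> int (v * (f - f x)) dmu in the form.  Testing it with
    green R x y shows that the integral equation reads
    v = - alpha * eta + constant, so that v belongs to F and solves the same
    variational equation as u.  Their difference has zero energy, hence is
    constant, and has zero mean. *)
Lemma resolvent_unique v : continuous v -> alpha * average mu v = 1 ->
  (forall y, v y = v x - alpha * average mu (v \* green R x y)) -> v = u.
Proof.
move=> cv mean_v vE.
have [M vM] := continuous_bounded cv.
have [D RD] := continuous_bounded (@continuous_slice _ _ _ cR x).
have D0 : 0 <= D by apply: le_trans (RD x).
have M0 : 0 <= M by apply: le_trans (vM x).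
pose l f := average mu (v \* (f \- cst (f x))).
have cfx f : F f -> continuous (f \- cst (f x)).
  by move=> Ff; apply: c_rf; apply: (rfB rf) => //; exact: (rf_cst rf).
have lE f : F f -> l f = average mu (v \* f) - f x / alpha.
  move=> Ff; have cvf := continuousM_fun cv (c_rf Ff).
  have -> : l f = average mu ((- f x) \*o v \+ (v \* f)).
    by congr average; apply/funext => z /=; ring.
  rewrite average_linear//; have := mean_v; have := alpha0.
  by move=> al0 ala; have -> : average mu v = alpha^-1; [
    rewrite -[LHS](mulKf (lt0r_neq0 al0)) ala mulr1|ring].
have [|||eta Feta etaE] := rf_riesz rf (l := l) (C := M ^+ 2 * D).
- by rewrite mulr_ge0// sqr_ge0.
- move=> a f g Ff Fg; rewrite -average_linear//;
    try by apply: continuousM_fun => //; exact: cfx.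
  by congr average; apply/funext => z /=; ring.
- move=> f Ff; rewrite -real_normK ?num_real//.
  have Ef := rf_ge0 rf Ff.
  have : `|l f| <= M * Num.sqrt (D * E f f).
    apply: average_le => //; first by apply: continuousM_fun => //; exact: cfx.
    move=> z /=; rewrite normrM ler_pM//.
    rewrite -sqrtr_sqr ler_sqrt ?mulr_ge0//.
    have := rf_oscillation rf Rxx RE x z Ff; rewrite -(sqrrN (f z - _)) opprB.
    move/le_trans; apply; rewrite ler_wpM2r//.
    by apply: le_trans (RD z); exact: ler_norm.
  move=> lb; rewrite -mulrA -[D * _]sqr_sqrtr ?mulr_ge0// -exprMn.
  by rewrite ler_pXn2r// nnegrE mulr_ge0// sqrtr_ge0.
have Fc a := rf_cst rf (a : K).
have v_eta : v = (- alpha) \*o eta \+ cst (v x + alpha * eta x).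
  apply/funext => y /=; have [Fg gE] := rf_green rf Rxx RE x y.
  have := etaE _ Fg; rewrite (rf_sym rf Feta Fg) gE// lE// green_pole mul0r subr0.
  rewrite vE => <-; ring.
have Fv : F v by rewrite v_eta; exact: (rf_linear rf _ Feta (Fc _)).
have vf f : F f -> E v f + alpha * average mu (v \* f) = f x.
  move=> Ff; rewrite [in E v f]v_eta (rf_bilinear rf)// (rf_cstl rf)// etaE// lE//.
  by field; exact: lt0r_neq0.
have Fw := rfB rf Fv Fu; set w := v \- u in Fw.
have wf f : F f -> E w f + alpha * average mu (w \* f) = 0.
  move=> Ff; rewrite (rfBl rf)//.
  have -> : average mu (w \* f) = average mu ((-1) \*o (u \* f) \+ (v \* f)).
    by congr average; apply/funext => z /=; rewrite /w /=; ring.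
  rewrite average_linear//; try by apply: continuousM_fun => //; exact: c_rf.
  have := vf f Ff; have := uE Ff; lra.
have Eww : E w w = 0.
  have := wf w Fw; have := rf_ge0 rf Fw; have : 0 <= average mu (w \* w).
    by apply: average_ge0 => z /=; rewrite -expr2 sqr_ge0.
  have := alpha0; move: (average mu _) (E w w) => a b; nra.
have [c wc] := (rf_eq0 rf Fw).1 Eww.
have := wf _ (Fc 1); rewrite wc (rf_cstl rf)// add0r.
have -> : (cst c \* cst 1 : A -> K) = cst c by apply/funext => z /=; rewrite mulr1.
rewrite average_cst// => /eqP; rewrite mulf_eq0 (gt_eqF alpha0)/= => /eqP c0.
apply/funext => z; apply/eqP; rewrite -subr_eq0; apply/eqP.
by rewrite -[LHS]/(w z) wc c0.
Qed.

End Kernel.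
End Resolvent.

(** * Convergence of resolvent kernels *)

Section ResolventKernel.
Context {K : realType} {B : pmetricType K} {A : set B}.
Context {mu : probability (borelType B) K} {R : A -> A -> K} {alpha : K}.
Hypotheses (compactB : compact [set: B]) (clA : closed A) (muA : mu A = 1%E).
Hypothesis Rxx : forall x, R x x = 0.
Hypothesis cR : continuous (fun p : (A * A)%type => R p.1 p.2).
Hypothesis alpha0 : 0 < alpha.
Context {u : A -> A -> K}.
Hypothesis uR : resolvent_kernel R mu alpha u.

(** What the limit argument uses of a resolvent kernel: properties that involve only
    R, mu, alpha and u, and therefore pass to the limit although each R_ n comes with
    its own form. *)
Lemma resolvent_kernel_facts x :
  [/\ continuous (u x), alpha * average mu (u x) = 1,
    forall y, u x y = u x x - alpha * average mu (u x \* green R x y),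
    forall y z, 0 <= R y z /\ (u x y - u x z) ^+ 2 <= R y z * u x x
    & 0 <= u x x /\ forall D, (forall z, R x z <= D) -> u x x <= 2 / alpha + D].
Proof.
have [E [F [[rf RE] /(_ x)[Fu uE]]]] := uR.
have uE' f : F f -> E (u x) f + alpha * average mu (u x \* f) = f x.
  by move=> Ff; rewrite -form_alphaE; exact: uE.
have osc := resolvent_oscillation Rxx rf RE alpha0 Fu uE'.
split.
- exact: (resistance_modulus_continuous cR Rxx osc).
- exact: (resolvent_mean rf Fu uE').
- exact: (resolvent_green Rxx rf RE Fu uE').
- by move=> y z; split; [exact: (rf_resistance_ge0 rf Rxx RE)|exact: osc].
split; first exact: le_trans (rf_ge0 rf Fu) (resolvent_energy alpha0 Fu uE').
exact: (resolvent_bound compactB clA muA Rxx cR rf RE alpha0 Fu uE').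
Qed.

Lemma resolvent_kernel_unique x v : continuous v -> alpha * average mu v = 1 ->
  (forall y, v y = v x - alpha * average mu (v \* green R x y)) -> v = u x.
Proof.
have [E [F [[rf RE] /(_ x)[Fu uE]]]] := uR.
apply: (resolvent_unique compactB clA muA Rxx cR rf RE alpha0 Fu) => f Ff.
by rewrite -form_alphaE; exact: uE.
Qed.

End ResolventKernel.

Section Limit.
Context {K : realType} {B : pmetricType K}.
Hypothesis compactB : compact [set: B].
Context {A_ : nat -> set B} {A : set B}.
Hypotheses (clA_ : forall n, closed (A_ n)) (clA : closed A).
Hypothesis cvgA : hausdorff_dist (A_ n) A @[n --> \oo] --> 0%E.
Hypothesis A_neq0 : forall n, exists x, A_ n x.
Context {mu_ : nat -> probability (borelType B) K} {mu : probability (borelType B) K}.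
Hypotheses (muA_ : forall n, mu_ n (A_ n) = 1%E) (muA : mu A = 1%E).
Hypothesis cvg_mu : weak_cvg mu_ mu.
Context {R_ : forall n, A_ n -> A_ n -> K} {R : A -> A -> K}.
Arguments R_ : clear implicits.
Hypotheses (R_xx : forall n x, R_ n x x = 0) (Rxx : forall x, R x x = 0).
Hypothesis cR_ : forall n, continuous (fun p : (A_ n * A_ n)%type => R_ n p.1 p.2).
Hypothesis cR : continuous (fun p : (A * A)%type => R p.1 p.2).
Hypothesis cvgR : cvg_along R_ R.
Context {alpha : K}.
Hypothesis alpha0 : 0 < alpha.
Context {u_ : forall n, A_ n -> A_ n -> K} {u : A -> A -> K}.
Arguments u_ : clear implicits.
Hypothesis u_R : forall n, resolvent_kernel (R_ n) (mu_ n) alpha (u_ n).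
Hypothesis uR : resolvent_kernel R mu alpha u.

Let facts_ n := resolvent_kernel_facts compactB (@clA_ n) (muA_ n) (@R_xx n)
  (@cR_ n) alpha0 (u_R n).

Section Ultralimit.
Context {U : set_system nat} {x_ : forall n, A_ n} {x : A}.
Hypotheses (UU : UltraFilter U) (ooU : \oo `<=` U).
Hypothesis xx : set_val (x_ n) @[n --> U] --> (set_val x : B).

Let URcvg (p_ q_ : forall n, A_ n) (p q : A) :
  set_val (p_ n) @[n --> U] --> (set_val p : B) ->
  set_val (q_ n) @[n --> U] --> (set_val q : B) ->
  R_ n (p_ n) (q_ n) @[n --> U] --> R p q.
Proof. exact: cvg_along_ultra. Qed.

Lemma resolvent_uniform_bound : exists M, \forall n \near U,
  0 <= u_ n (x_ n) (x_ n) <= M /\ forall z, `|u_ n (x_ n) z| <= M.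
Proof.
have [D RD] := continuous_bounded compactB clA (@continuous_slice _ _ _ cR x).
have D0 : 0 <= D by apply: le_trans (RD x).
have UD : \forall n \near U, forall z, R_ n (x_ n) z <= D + 1.
  apply: filter_selection => [n|p_].
    by have [a Aa] := cid (A_neq0 n); exact: SigSub (mem_set Aa).
  have [p pp] := hausdorff_ultra_limit cvgA p_ compactB clA UU ooU.
  have lt : R x p < D + 1.
    by rewrite (le_lt_trans (ler_norm _))// (le_lt_trans (RD p))// ltrDl.
  by apply: filterS (cvgr_lt _ (URcvg xx pp) _ lt) => n /ltW.
pose M0 := 2 / alpha + (D + 1).
have M00 : 0 < M0 by rewrite addr_gt0 ?divr_gt0//; lra.
exists (M0 + 1 + (D + 1) * M0); apply: filterS UD => n RDn.
have [_ _ _ osc [ux0 /(_ _ RDn) uxM]] := facts_ (x_ n).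
have ME : 0 <= (D + 1) * M0 by rewrite mulr_ge0// ?ltW//; lra.
split=> [|z]; first by rewrite ux0 -/M0 /= (le_trans uxM)// -/M0 -addrA lerDl; lra.
have [Rz0 oscz] := osc (x_ n) z.
have {oscz} : (u_ n (x_ n) (x_ n) - u_ n (x_ n) z) ^+ 2 <= (D + 1) * M0.
  by apply: le_trans oscz _; apply: ler_pM.
move: uxM ux0 ME; rewrite -/M0.
move: (u_ n (x_ n) (x_ n)) (u_ n (x_ n) z) ((D + 1) * M0) => a q E aM a0 E0 aq.
by rewrite ler_norml; apply/andP; split; nra.
Qed.

(** The limit v of u_ n (x_ n) is built at the approximants phi n z; the oscillation
    bound extends the convergence to all points that tend to z, and shows that v
    is continuous.  The equations of resolvent_kernel_facts then pass to the limit,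
    and uniqueness identifies v with u x. *)
Lemma resolvent_ultralimit (y_ : forall n, A_ n) (y : A) :
  set_val (y_ n) @[n --> U] --> (set_val y : B) ->
  u_ n (x_ n) (y_ n) @[n --> U] --> u x y.
Proof.
move=> yy; have [phi phiP] := hausdorff_approx cvgA A_neq0.
have Uphi z : set_val (phi n z) @[n --> U] --> (set_val z : B).
  by move=> W /(phiP z); exact: ooU.
have [M UM] := resolvent_uniform_bound.
have /choice[v vP] z : exists l : K, u_ n (x_ n) (phi n z) @[n --> U] --> l.
  by apply: (@bounded_ultra_cvg _ _ _ _ M UU); apply: filterS UM => n [].
have v_lim (p_ : forall n, A_ n) (p : A) :
    set_val (p_ n) @[n --> U] --> (set_val p : B) ->
    u_ n (x_ n) (p_ n) @[n --> U] --> v p.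
  move=> pp; have RM : R_ n (p_ n) (phi n p) * M @[n --> U] --> (0 : K).
    by rewrite -(mul0r M) -(Rxx p); apply: cvgM; [exact: URcvg|exact: cvg_cst].
  have d0 : u_ n (x_ n) (p_ n) - u_ n (x_ n) (phi n p) @[n --> U] --> (0 : K).
    apply/cvgr0Pnorm_lt => e e0; have e2 : 0 < e ^+ 2 by rewrite exprn_gt0.
    apply: filterS2 UM (cvgr_lt _ RM _ e2) => n [/andP[_ uxM] _] lt.
    have [_ _ _ /(_ (p_ n) (phi n p))[R0 osc] _] := facts_ (x_ n).
    rewrite -(ltr_pXn2r (n := 2))// ?nnegrE ?(ltW e0)// real_normK ?num_real//.
    by apply: le_lt_trans lt; apply: le_trans osc _; rewrite ler_wpM2l.
  rewrite (_ : (fun n => _) = (fun n => (u_ n (x_ n) (p_ n) - u_ n (x_ n) (phi n p)) +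
    u_ n (x_ n) (phi n p))); last by apply/funext => n; rewrite subrK.
  by rewrite -[v p]add0r; apply: cvgD => //; exact: vP.
have v_osc (p q : A) : (v p - v q) ^+ 2 <= R p q * M.
  have d2 : (u_ n (x_ n) (phi n p) - u_ n (x_ n) (phi n q)) ^+ 2 @[n --> U]
      --> (v p - v q) ^+ 2 by apply: cvgM; apply: cvgB; exact: vP.
  have RM : R_ n (phi n p) (phi n q) * M @[n --> U] --> R p q * M.
    by apply: cvgM; [exact: URcvg|exact: cvg_cst].
  apply: ler_cvg_to d2 RM _; apply: filterS UM => n [/andP[_ uxM] _].
  have [_ _ _ /(_ (phi n p) (phi n q))[R0 osc] _] := facts_ (x_ n).
  by apply: le_trans osc _; rewrite ler_wpM2l.
have cv : continuous v := resistance_modulus_continuous cR Rxx v_osc.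
have cu n : continuous (u_ n (x_ n)) by have [] := facts_ (x_ n).
have avg_lim := average_ultralimit compactB UU ooU cvgA A_neq0 (@clA_) clA muA_ muA
  cvg_mu.
rewrite -(resolvent_kernel_unique compactB clA muA Rxx cR alpha0 uR cv).
- exact: v_lim.
- have : alpha * average (mu_ n) (u_ n (x_ n)) @[n --> U] --> alpha * average mu v.
    by apply: cvgM; [exact: cvg_cst|exact: avg_lim].
  move=> h; apply: (cvg_unique _ h) => //; apply: cvg_near_cst; apply: nearW => n.
  by have [] := facts_ (x_ n).
move=> z; apply: (cvg_unique _ (vP z)) => //.
rewrite (_ : (fun n => _) = fun n => u_ n (x_ n) (x_ n) -
  alpha * average (mu_ n) (u_ n (x_ n) \* green (R_ n) (x_ n) (phi n z))); last first.
  by apply/funext => n; have [] := facts_ (x_ n).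
apply: cvgB; first exact: v_lim.
apply: cvgM; first exact: cvg_cst.
apply: avg_lim => [n||p_ p pp].
- by apply: continuousM_fun; [exact: cu|exact: (@continuous_green _ _ _ (@cR_ n))].
- by apply: continuousM_fun; [exact: cv|exact: (@continuous_green _ _ _ cR)].
apply: cvgM; first exact: v_lim.
apply: cvgM; first exact: cvg_cst.
by apply: cvgB; [apply: cvgD|]; exact: URcvg.
Qed.

End Ultralimit.
End Limit.

Theorem theorem2p17 (K : realType) (B : pmetricType K)
  (compactB : compact [set: B])
  (A_ : nat -> set B) (A : set B)
  (compactA_ : forall n, compact (A_ n)) (compactA : compact A)
  (cvgA : hausdorff_dist (A_ n) A @[n --> \oo] --> 0%E)
  (mu_ : nat -> probability (borelType B) K) (mu : probability (borelType B) K)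
  (supp_mu_ : forall n, measure_support (mu_ n) = A_ n)
  (supp_mu : measure_support mu = A)
  (cvg_mu : weak_cvg mu_ mu)
  (R_ : forall n, A_ n -> A_ n -> K) (R : A -> A -> K)
  (resistanceR_ : forall n, resistance_metric (R_ n))
  (continuousR_ : forall n,
    continuous (fun p : (A_ n * A_ n)%type => R_ n p.1 p.2))
  (metricR : is_metric R)
  (cvgR : cvg_along R_ R) :
  [/\ resistance_metric R,
      continuous (fun p : (A * A)%type => R p.1 p.2)
    & forall alpha : K, 0 < alpha ->
      forall (u_ : forall n, A_ n -> A_ n -> K) (u : A -> A -> K),
        (forall n, resolvent_kernel (R_ n) (mu_ n) alpha (u_ n)) ->
        resolvent_kernel R mu alpha u ->
        cvg_along u_ u].
Proof.
have clA_ n : closed (A_ n) := compact_closed (@metric_hausdorff _ B) (compactA_ n).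
have clA : closed A := compact_closed (@metric_hausdorff _ B) compactA.
have muA_ n := measure_support_full compactB (clA_ n) (supp_mu_ n).
have muA := measure_support_full compactB clA supp_mu.
have A_neq0 n : exists x, A_ n x.
  apply: contrapT => A0; have := muA_ n.
  rewrite (_ : A_ n = set0) ?measure0; last first.
    by apply/seteqP; split => // x Ax; apply: A0; exists x.
  by move=> /esym/eqP; rewrite onee_eq0.
have cR := cvg_along_continuous cvgA A_neq0 cvgR.
split; [|exact: cR|].
  exact: resistance_metric_limit cvgA A_neq0 resistanceR_ metricR cvgR.
move=> alpha alpha0 u_ u u_R uR x y x_ y_ xx yy; apply: cvg_ultra => U UU ooU.
apply: (@resolvent_ultralimit _ _ compactB A_ A clA_ clA cvgA A_neq0 mu_ mu muA_ muA
  cvg_mu R_ R _ _ continuousR_ cR cvgR alpha alpha0 u_ u u_R uR U x_ x UU ooU).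
- by move=> n z; exact: resistance_metric_xx.
- exact: metric_xx metricR.
- by move=> W /xx; exact: ooU.
- by move=> W /yy; exact: ooU.
Qed.
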